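(* Assume the setting and Algorithm SC described in the context, and suppose Assumptions (A1)–(A4) hold. Suppose the step-size sequences satisfy (i) $\sum_{k=1}^{\infty}\alpha_{ij,k}^2<\infty$ and $\sup_{k}\alpha_{ij,k+1}/\alpha_{ij,k}<\infty$ for all $(i,j)\in\mathcal{E}$; (ii) $\sum_{k=1}^{\infty}\beta_{i,k}^2<\infty$ and $\sup_k \beta_{i,k+1}/\beta_{i,k}<\infty$ for all $i\in\mathcal{V}$; (iii) $\sum_{k=1}^{\infty} z_k=\infty$, where $z_k=\min\{\alpha_{ij,k}/k^{\nu_{ij}},\ (i,j)\in\mathcal{E};\ \beta_{i,k},\ i\in\mathcal{V}\}$. Then for every $i\in\mathcal{V}$, $\hat\theta_{i,k}\to\theta$ almost surely as $k\to\infty$.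
   Context: Network: undirected weighted graph with sensor set $\mathcal{V}=\{1,\dots,N\}$, symmetric nonnegative weights $a_{ij}=a_{ji}$, with $a_{ij}>0$ iff $(i,j)\in\mathcal{E}$; the edge set $\mathcal{E}$ is regarded as a set of ordered pairs that is symmetric ($(i,j)\in\mathcal{E}\iff(j,i)\in\mathcal{E}$), $M=|\mathcal{E}|/2$ is the number of undirected edges, and $\mathcal{N}_i=\{j:(i,j)\in\mathcal{E}\}$. The Laplacian is $\mathcal{L}=\mathcal{D}-\mathcal{A}$ with $\mathcal{A}=(a_{ij})$, $\mathcal{D}=\mathrm{diag}(\sum_{j\in\mathcal{N}_i}a_{ij})$; $\lambda_2(\mathcal{L})$ is its second smallest eigenvalue. Observations: unknown $\theta\in\mathbb{R}^n$; sensor $i$ observes $y_{i,k}=H_{i,k}\theta+w_{i,k}$, $k\ge1$, with deterministic $H_{i,k}\in\mathbb{R}^{m_i\times n}$ and noise $w_{i,k}\in\mathbb{R}^{m_i}$. Let $d_{i,k}$ ($i\in\mathcal{V},k\ge1$) be the dithering noises used below, $\mathcal{F}_k=\sigma(w_{i,t},d_{i,t}: i\in\mathcal{V},1\le t\le k)$ and $\mathcal{F}^w_k=\sigma(w_{i,t}: i\in\mathcal{V},1\le t\le k)$. Assumptions. (A1) There is $\bar H>0$ with $\|H_{i,k}\|\le\bar H$ for all $i,k$, and there are a positive integer $p$ and $\delta>0$ with $\frac1p\sum_{t=k}^{k+p-1}\sum_{i=1}^N H_{i,t}^\top H_{i,t}\ge\delta I_n$ for all $k\ge1$. (A2) $\{w_{i,k},\mathcal{F}_k\}$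 is a martingale difference sequence and $\sup_{i,k}\mathbb{E}[\|w_{i,k}\|^\rho\mid\mathcal{F}^w_{k-1}]<\infty$ a.s. for some $\rho>2$. (A3) The graph is connected, i.e. $\mathrm{rank}(\mathcal{L})=N-1$. (A4) The $d_{i,k}$ are i.i.d. with the Laplace distribution $\mathrm{Lap}(0,1)$ (density $f(x)=\frac12e^{-|x|}$, distribution function $F$), mutually independent over all $(i,k)$, and independent of all $w_{j,t}$. Algorithm SC. Inputs: deterministic initial estimates $\hat\theta_{i,0}\in\mathbb{R}^n$; event-triggered coefficients $\nu_{ij}=\nu_{ji}\ge0$; noise coefficients $b_{ij}=b_{ji}>0$; step sizes $\alpha_{ij,k}=\alpha_{ji,k}>0$ ($(i,j)\in\mathcal{E}$) and $\beta_{i,k}>0$. For $k=1,2,\dots$: let $\varphi_k\in\mathbb{R}^n$ be the $l$-th standard basis vector, where $k=nq+l$ with $q\in\mathbb{N}\cup\{0\}$, $l\in\{1,\dots,n\}$; set $x_{i,k}=\varphi_k^\top\hat\theta_{i,k-1}$; set $C_{ij,k}=\nu_{ij}b_{ij}\ln k$; set $s_{ij,k}=1$ if $x_{i,k}+b_{ij}d_{i,k}>0$ and $s_{ij,k}=-1$ otherwise. Sensor $i$ sends the one-bit message $s_{ij,k}$ to neighbor $j$ iff $|x_{i,k}+b_{ij}d_{i,k}|>C_{ij,k}$; sensor $i$ sets $\hat s_{ji,k}=s_{ji,k}$ if it received $s_{ji,k}$ from $j$, and $\hat s_{ji,k}=0$ otherwise. With $G_{ij,k}(x)=F((x-C_{ij,k})/b_{ij})-F((-x-C_{ij,k})/b_{ij})$,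 update $\check\theta_{i,k}=\hat\theta_{i,k-1}+\varphi_k\sum_{j\in\mathcal{N}_i}\alpha_{ij,k}a_{ij}(\hat s_{ji,k}-G_{ij,k}(x_{i,k}))$, $\hat\theta_{i,k}=\check\theta_{i,k}+\beta_{i,k}H_{i,k}^\top(y_{i,k}-H_{i,k}\hat\theta_{i,k-1})$. Write $\tilde\theta_{i,k}=\hat\theta_{i,k}-\theta$. *)

(* Defs.v *)
From HB Require Import structures.
From mathcomp Require Import all_boot all_order all_algebra.
From mathcomp Require Import all_classical all_reals all_analysis measurable_realfun.
Set Implicit Arguments. Unset Strict Implicit. Unset Printing Implicit Defensive.
Import Order.TTheory GRing.Theory Num.Theory.
Import numFieldNormedType.Exports.
Local Open Scope classical_set_scope.
Local Open Scope ring_scope.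

Section Defs.
Context {R : realType}.

Definition vnorm {n : nat} (v : 'cV[R]_n) : R :=
  Num.sqrt (\sum_(r < n) v r 0 ^+ 2).

Definition opnorm_le {m n : nat} (M : 'M[R]_(m, n)) (c : R) : Prop :=
  forall x : 'cV[R]_n, vnorm (M *m x) <= c * vnorm x.

Definition loewner_ge {n : nat} (A B : 'M[R]_n) : Prop :=
  forall x : 'cV[R]_n, 0 <= (x^T *m (A - B) *m x) 0 0.

Definition laplacian {N : nat} (a : 'M[R]_N) : 'M[R]_N :=
  \matrix_(i, j) ((i == j)%:R * (\sum_(l | 0 < a i l) a i l) - a i j).

Definition lap_pdf (x : R) : R := 2^-1 * expR (- `|x|).
Definition lap_cdf (x : R) : R :=
  if x < 0 then 2^-1 * expR x else 1 - 2^-1 * expR (- x).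

(* phi_k = l-th standard basis vector, k = n q + l, 1 <= l <= n
   (i.e. the coordinate (k-1) mod n, 0-based). *)
Definition phi (n k : nat) : 'cV[R]_n := \col_(r < n) ((r : nat) == (k.-1 %% n)%N)%:R.

Definition sc_step (N n : nat) (m : 'I_N -> nat)
  (a : 'M[R]_N) (nu b : 'I_N -> 'I_N -> R)
  (alpha : 'I_N -> 'I_N -> nat -> R) (beta : 'I_N -> nat -> R)
  (H : forall i : 'I_N, nat -> 'M[R]_(m i, n)) (theta : 'cV[R]_n)
  (wk : forall i : 'I_N, 'cV[R]_(m i)) (dk : 'I_N -> R)
  (k : nat) (prev : 'I_N -> 'cV[R]_n) : 'I_N -> 'cV[R]_n :=
  fun i =>
  let x := fun l : 'I_N => ((phi n k)^T *m prev l) 0 0 in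
  let C := fun l j : 'I_N => nu l j * b l j * ln (k%:R) in
  let s := fun l j : 'I_N => if 0 < x l + b l j * dk l then 1 else -1 : R in
  (* hat s_{ji,k} as received by sensor i from neighbour j *)
  let shat := fun j l : 'I_N =>
    if C j l < `|x j + b j l * dk j| then s j l else 0 in
  let G := fun l j : 'I_N => fun z : R =>
    lap_cdf ((z - C l j) / b l j) - lap_cdf ((- z - C l j) / b l j) in
  let y := H i k *m theta + wk i in
  let check := prev i + (\sum_(j | 0 < a i j)
        alpha i j k * a i j * (shat j i - G i j (x i))) *: phi n k in
  check + beta i k *: ((H i k)^T *m (y - H i k *m prev i)).

Fixpoint sc_est (N n : nat) (m : 'I_N -> nat)
  (a : 'M[R]_N) (nu b : 'I_N -> 'I_N -> R)
  (alpha : 'I_N -> 'I_N -> nat -> R) (beta : 'I_N -> nat -> R)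
  (H : forall i : 'I_N, nat -> 'M[R]_(m i, n)) (theta : 'cV[R]_n)
  (theta0 : 'I_N -> 'cV[R]_n) {T : Type}
  (w : forall i : 'I_N, nat -> T -> 'cV[R]_(m i)) (d : 'I_N -> nat -> T -> R)
  (k : nat) (om : T) : 'I_N -> 'cV[R]_n :=
  match k with
  | 0 => theta0
  | k'.+1 => sc_step a nu b alpha beta H theta (fun i => w i k'.+1 om)
               (fun i => d i k'.+1 om) k'.+1
               (sc_est a nu b alpha beta H theta theta0 w d k' om)
  end.

(* Generators of F_k = sigma(w_{i,t}, d_{i,t} : i, 1 <= t <= k) and of
   F^w_k = sigma(w_{i,t} : i, 1 <= t <= k). *)
Definition gen_w {N : nat} {m : 'I_N -> nat} {T : Type}
  (w : forall i : 'I_N, nat -> T -> 'cV[R]_(m i)) (k : nat) : set (set T) :=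
  [set A | exists i t (c : 'I_(m i)) (B : set R),
      (1 <= t <= k)%N /\ measurable B /\ A = (fun om => w i t om c 0) @^-1` B].

Definition gen_d {N : nat} {T : Type} (d : 'I_N -> nat -> T -> R) (k : nat)
  : set (set T) :=
  [set A | exists i t (B : set R),
      (1 <= t <= k)%N /\ measurable B /\ A = d i t @^-1` B].

Definition gen_w_all {N : nat} {m : 'I_N -> nat} {T : Type}
  (w : forall i : 'I_N, nat -> T -> 'cV[R]_(m i)) : set (set T) :=
  \bigcup_(k in setT) gen_w w k.

End Defs.

(* Main.v *)
Require Import Defs.
From HB Require Import structures.
From mathcomp Require Import all_boot all_order all_algebra.
From mathcomp Require Import all_classical all_reals all_analysis measurable_realfun.
From mathcomp Require Import ring lra.
Import Order.TTheory GRing.Theory Num.Theory.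
Import numFieldNormedType.Exports.
Local Open Scope classical_set_scope.
Local Open Scope ring_scope.
Set Implicit Arguments. Unset Strict Implicit. Unset Printing Implicit Defensive.

(** The Lyapunov function is [V = sum_i |err_i|^2].  One step of the algorithm gives
    [V' <= V - 2 D + 2 m + r (1 + V)], where [D >= 0] collects the consensus and
    observation terms, [m] is a martingale difference and [r] is summable.  Since
    [m / (1 + V)] has uniformly bounded predictable weights, its series converges almost
    surely without any a priori bound on [V]; comparing [ln (1 + V)] with this series
    shows pathwise that [V] converges and that [D] is summable.  On bounded sets the
    averaged one-bit message has slope at least a constant times [k^(-nu)], so summability
    of [D] controls [sum_k z_k E_k], where the quadratic form [E_k], summed over a window
    of [n + p] steps, dominates [V] up to vanishing increments (connectivity of the graph
    and persistent excitation).  As [sum_k z_k] diverges, the limit of [V] is [0]. *)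

(** * The Laplace distribution function *)

(** A threshold divided by its noise coefficient equals [nu * ln k], and the Laplace density decays
    exponentially, so its value there is a constant times [k^(-nu)]: this is the origin of the
    powers in [z_k]. That constant also depends on the range of the estimates, which is not bounded
    in advance. This fixes the order of the argument: [V] is first shown to converge on the outcome
    at hand, using only that the mean message is monotone, and the slope bound comes afterwards,
    with a constant that depends on the outcome.

    A martingale difference is described by vanishing integrals over the events of the past, so that
    multiplication by a bounded predictable weight becomes a statement about integrals. Probability
    enters through countably many scalar series; what follows them is an argument about one fixed
    outcome. The conditional moments of [w] have only a random bound, so the series involving [w]
    are treated at every integer truncation level, and each outcome selects a level that leaves it
    unchanged. *)

Section Laplace.
Context (R : realType).
Implicit Types x y K : R.

Lemma lap_cdfN x : lap_cdf (- x) = 1 - lap_cdf x.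
Proof.
rewrite /lap_cdf oppr_lt0 opprK; case: ltgtP => [x0|x0|<-]; try lra.
by rewrite oppr0 expR0; lra.
Qed.

Lemma lap_cdfE_ge0 x : 0 <= x -> lap_cdf x = 1 - 2^-1 * expR (- x).
Proof. by rewrite /lap_cdf ltNge => ->. Qed.

Lemma lap_cdfE_le0 x : x <= 0 -> lap_cdf x = 2^-1 * expR x.
Proof.
rewrite /lap_cdf le_eqVlt => /orP[/eqP->|->//].
by rewrite ltxx oppr0 expR0; lra.
Qed.

(** Both inequalities are [1 + t <= expR t], at [t = y - x] and at [t = x - y], multiplied by an
    exponential. *)
Let expR_diff x y : x <= y -> expR x * (y - x) <= expR y - expR x <= expR y * (y - x).
Proof.
move=> xy; have h1 := expR_ge1Dx (y - x); have h2 := expR_ge1Dx (x - y).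
have e1 : expR x * expR (y - x) = expR y by rewrite -expRD; congr expR; ring.
have e2 : expR y * expR (x - y) = expR x by rewrite -expRD; congr expR; ring.
by have := expR_gt0 x; have := expR_gt0 y; nra.
Qed.

(** The density lies between 0 and 1/2; the rougher constant 1 is enough for the monotonicity and
    continuity wanted from this lemma. *)
Lemma lap_cdf_lip x y : x <= y -> 0 <= lap_cdf y - lap_cdf x <= y - x.
Proof.
move=> xy.
(* Only nonnegative arguments are computed; the reflection [lap_cdfN] gives the negative ones, and
   an interval around 0 is cut at 0. *)
have pos (u v : R) : 0 <= u -> u <= v -> 0 <= lap_cdf v - lap_cdf u <= v - u.
  move=> u0 uv; rewrite (lap_cdfE_ge0 u0) (lap_cdfE_ge0 (le_trans u0 uv)).
  have := @expR_diff (- v) (- u); rewrite lerN2 => /(_ uv).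
  have : expR (- u) <= 1 by rewrite -expR0 ler_expR oppr_le0.
  by have := expR_gt0 (- v); nra.
have [x0|x0] := leP 0 x; first exact: pos.
have [y0|y0] := leP 0 y.
  have := pos 0 y (lexx _) y0; have := pos 0 (- x) (lexx _); rewrite lap_cdfN.
  have : lap_cdf (0 : R) = 2^-1 by rewrite lap_cdfE_le0// expR0; lra.
  lra.
have := pos (- y) (- x); rewrite !lap_cdfN; lra.
Qed.

(** On [[- K, K]] the density is smallest at the endpoints, where it equals [2^-1 * expR (- K)]. *)
Lemma lap_cdf_slope K x y : - K <= x -> x <= y -> y <= K ->
  2^-1 * expR (- K) * (y - x) <= lap_cdf y - lap_cdf x.
Proof.
move=> Kx xy yK.
have pos (u v : R) : 0 <= u -> u <= v -> v <= K ->
    2^-1 * expR (- K) * (v - u) <= lap_cdf v - lap_cdf u.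
  move=> u0 uv vK; rewrite (lap_cdfE_ge0 u0) (lap_cdfE_ge0 (le_trans u0 uv)).
  have := @expR_diff (- v) (- u); rewrite lerN2 => /(_ uv).
  have : expR (- K) <= expR (- v) by rewrite ler_expR lerN2.
  by have := expR_gt0 (- K); nra.
have [x0|x0] := leP 0 x; first exact: pos.
have [y0|y0] := leP 0 y.
  have := pos 0 y (lexx _) y0 yK; have := pos 0 (- x) (lexx _); rewrite lap_cdfN.
  have : lap_cdf (0 : R) = 2^-1 by rewrite lap_cdfE_le0// expR0; lra.
  set e := expR _; lra.
have := pos (- y) (- x); rewrite !lap_cdfN; set e := expR _; lra.
Qed.

Lemma lap_cdf_ge0 x : 0 <= lap_cdf x.
Proof.
have [x0|x0] := leP 0 x; last first.
  by rewrite (lap_cdfE_le0 (ltW x0)); have := expR_gt0 x; lra.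
rewrite lap_cdfE_ge0//.
have : expR (- x) <= 1 by rewrite -expR0 ler_expR oppr_le0.
lra.
Qed.

Lemma lap_cdf_le1 x : lap_cdf x <= 1.
Proof. by have := lap_cdf_ge0 (- x); rewrite lap_cdfN; lra. Qed.

Lemma measurable_lap_cdf : measurable_fun setT (@lap_cdf R).
Proof.
apply: measurable_fun_ifT; first exact: measurable_fun_ltr.
  by apply: measurable_funM => //; exact: measurable_expR.
apply: measurable_funB => //; apply: measurable_funM => //.
by apply: measurableT_comp.
Qed.

End Laplace.

(** * Almost sure convergence of square-summable martingale series *)

Lemma sub_g_sigma (d : measure_display) (T : measurableType d) (G : set (set T)) :
  G `<=` measurable -> <<s G >> `<=` measurable.
Proof. by move=> sG; apply: smallest_sub => //; exact: sigma_algebra_measurable. Qed.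

Lemma measurable_g_sigma (d d' : measure_display) (T : measurableType d)
    (U : measurableType d') (G : set (set T)) (f : g_sigma_algebraType G -> U) :
  G `<=` measurable -> measurable_fun setT f -> measurable_fun setT (f : T -> U).
Proof. move=> sG mf _ B mB; by apply: (sub_g_sigma sG); exact: mf. Qed.

Lemma measurable_set_lt (d : measure_display) (T : measurableType d) (R : realType)
    (f g : T -> R) : measurable_fun setT f -> measurable_fun setT g ->
  measurable [set x | f x < g x].
Proof.
move=> mf mg; have mb := measurable_fun_ltr mf mg.
by rewrite -[X in measurable X]setTI; exact: (mb measurableT [set true]).
Qed.

Lemma integrable_bounded_mul (d : measure_display) (T : measurableType d) (R : realType)
    (P : {measure set T -> \bar R}) (X Y : T -> R) (C : R) :
  measurable_fun setT Y -> (forall x, `|Y x| <= C) ->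
  P.-integrable setT (EFin \o X) -> P.-integrable setT (fun x => (Y x * X x)%:E).
Proof.
move=> mY YC iX.
have mX : measurable_fun setT X by apply/measurable_EFinP; exact: measurable_int iX.
apply: (le_integrable measurableT (g := fun x => (C%:E * (X x)%:E)%E)).
- by apply/measurable_EFinP; exact: measurable_funM.
- move=> x _ /=; rewrite lee_fin !normrM ler_wpM2r//.
  exact: le_trans (YC x) (ler_norm _).
- exact: integrableZl.
Qed.

(** * Bounded predictable weights against centred variables *)

Section Weights.
Import HBNNSimple.
Context (d : measure_display) (T : measurableType d) (R : realType).
Context (P : {measure set T -> \bar R}) (G : set (set T)) (sG : G `<=` measurable).

Let simple_weight (X : T -> R) (h : {nnsfun g_sigma_algebraType G >-> R}) :
  P.-integrable setT (EFin \o X) ->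
  (forall A, <<s G >> A -> (\int[P]_(x in A) (X x)%:E = 0)%E) ->
  (\int[P]_x (h x * X x)%:E = 0)%E.
Proof.
move=> iX X0.
have mh y : <<s G >> (h @^-1` [set y]).
  by have := @measurable_funPTI _ _ _ _ h _ (measurable_set1 y).
have mhT y : measurable (h @^-1` [set y] : set T) by exact: (sub_g_sigma sG).
have iyX y : P.-integrable setT (fun x : T => (\1_(h @^-1` [set y] : set T) x * X x)%:E).
  apply: (@integrable_bounded_mul _ _ _ _ _ (\1_(h @^-1` [set y] : set T)) 1) => //.
  by move=> x; rewrite indicE; case: (_ \in _); rewrite ?normr1 ?normr0.
transitivity (\int[P]_x (\sum_(y <- finmap.enum_fset (fset_set (range h)))
    (y%:E * (\1_(h @^-1` [set y] : set T) x * X x)%:E)))%E.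
  apply: eq_integral => x _; rewrite (fimfunE h x) fsbig_finite//= mulr_suml -sumEFin.
  by apply: eq_bigr => y _; rewrite -mulrA EFinM.
rewrite integral_sum//; last by move=> y; exact: integrableZl.
rewrite big1// => y _; rewrite integralZl//.
have := X0 _ (mh y); rewrite integral_mkcond epatch_indic => H.
under eq_integral do rewrite EFinM muleC.
by rewrite H mule0.
Qed.

(** This is the rule for taking out a known factor, for a variable whose conditional expectation
    given [G] is zero. It holds for indicators by hypothesis and for simple functions by linearity;
    a bounded nonnegative weight is a limit of simple functions from below, and dominated
    convergence applies with the bound [K * |X|]. *)
Lemma integral_bounded_weight (X : T -> R) (Y : g_sigma_algebraType G -> R) (C : R) :
  P.-integrable setT (EFin \o X) ->
  (forall A, <<s G >> A -> (\int[P]_(x in A) (X x)%:E = 0)%E) ->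
  measurable_fun setT Y -> (forall x, `|Y x| <= C) ->
  (\int[P]_x (Y x * X x)%:E = 0)%E.
Proof.
move=> iX X0 mY YC.
have mX : measurable_fun setT X by apply/measurable_EFinP; exact: measurable_int iX.
have mYT : measurable_fun setT (Y : T -> R) by exact: measurable_g_sigma.
have ge0_case (Z : g_sigma_algebraType G -> R) (K : R) : measurable_fun setT Z ->
    (forall x, 0 <= Z x <= K) -> (\int[P]_x (Z x * X x)%:E = 0)%E.
  move=> mZ ZK.
  have mEZ : measurable_fun setT (EFin \o Z) by exact/measurable_EFinP.
  pose h := nnsfun_approx measurableT mEZ.
  have hcvg x : (EFin \o (fun n => h n x)) n @[n --> \oo] --> (Z x)%:E.
    by apply: cvg_nnsfun_approx => // y _; rewrite lee_fin; case/andP: (ZK y).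
  have hle n x : h n x <= Z x.
    rewrite -lee_fin -(cvg_lim _ (hcvg x))//.
    apply: lime_ge; first by apply/cvg_ex; exists (Z x)%:E.
    by exists n => // j /= nj; rewrite lee_fin; exact/lefP/nd_nnsfun_approx.
  have mh n : measurable_fun setT (h n : T -> R).
    by apply: (@measurable_g_sigma _ _ _ _ G) => //; exact: measurable_funP.
  have Hn n : (\int[P]_x (h n x * X x)%:E = 0)%E by exact: simple_weight.
  have H : (\int[P]_x (h n x * X x)%:E)%E @[n --> \oo] --> (\int[P]_x (Z x * X x)%:E)%E.
    apply: (@dominated_cvg _ _ _ _ _ _ _ _ (fun x => K%:E * `|(X x)%:E|)%E) => //.
    - by move=> n; apply/measurable_EFinP; exact: measurable_funM.
    - move=> x _; under eq_fun do rewrite EFinM.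
      by rewrite EFinM; apply: cvgeZr => //; exact: hcvg.
    - by apply: integrableZl => //; exact: integrable_abse.
    - move=> n x _; rewrite -EFinM/= lee_fin normrM ler_wpM2r// ger0_norm//.
      by apply: le_trans (hle n x) _; case/andP: (ZK x).
  move: H; under eq_fun do rewrite Hn.
  by move=> /(cvg_lim (@ereal_hausdorff R)) <-; rewrite lim_cst.
(* A signed weight is the difference of the nonnegative weight [Y + C] and the constant [C]. *)
have K1 : (\int[P]_x ((Y x + C) * X x)%:E = 0)%E.
  apply: (ge0_case (fun x => Y x + C) (C + C)); first exact: measurable_funD.
  by move=> x; move: (YC x); rewrite ler_norml; lra.
have K2 : (\int[P]_x (C * X x)%:E = 0)%E.
  under eq_integral do rewrite EFinM.
  rewrite integralZl// X0 ?mule0//.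
  exact: (@measurableT _ (g_sigma_algebraType G)).
have i1 : P.-integrable setT (EFin \o (fun x : T => (Y x + C) * X x)).
  apply: (@integrable_bounded_mul d T R P X (fun x : T => Y x + C) (`|C + C|)) => //.
    exact: measurable_funD.
  by move=> x; move: (YC x) (ler_norm (C + C)); rewrite !ler_norml; lra.
have i2 : P.-integrable setT (EFin \o (fun x => C * X x)).
  by rewrite /comp; under eq_fun do rewrite EFinM; exact: integrableZl.
transitivity (\int[P]_x (((Y x + C) * X x)%:E - (C * X x)%:E))%E.
  by apply: eq_integral => x _; rewrite -EFinB; congr EFin; ring.
by rewrite integralB_EFin// K1 K2 subee.
Qed.

End Weights.

(** Summability of a nonnegative sequence is expressed, here and below, by a common bound on its
    partial sums. Those increase to a limit, so from some index on they gain at most [e]. *)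
Lemma bounded_partial_sums_tail (R : realType) (v : nat -> R) (e : R) :
  (forall k, 0 <= v k) -> (exists B, forall k, \sum_(t < k) v t <= B) -> 0 < e ->
  exists n, forall k, \sum_(t < k) v (n + t)%N <= e.
Proof.
move=> v0 [B vB] e0; pose s k := \sum_(t < k) v t.
have nds : {homo s : n m / (n <= m)%N >-> n <= m}.
  apply/nondecreasing_seqP => n; rewrite /s big_ord_recr/= lerDl; exact: v0.
have cs : cvgn s by apply: nondecreasing_is_cvgn => //; exists B => _ [k _ <-]; exact: vB.
have /cvgrPdist_lt/(_ _ e0)[n _ /(_ n (leqnn n))/=] := cs.
move=> sn; exists n => k.
have -> : \sum_(t < k) v (n + t)%N = s (n + k)%N - s n.
  by rewrite /s big_split_ord/=; ring.
have := nondecreasing_cvgn_le nds cs (n + k)%N.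
by move: sn; rewrite ltr_norml; lra.
Qed.

Section MartingaleConvergence.
Context (d : measure_display) (T : measurableType d) (R : realType).
Context (P : probability T R) (G : nat -> set (set T)).
Context (sG : forall k, G k `<=` measurable).
Context (ndG : forall k, <<s G k >> `<=` <<s G k.+1 >>).
Context (X : nat -> T -> R).
Context (mX : forall k, measurable_fun setT (X k : g_sigma_algebraType (G k.+1) -> R)).
Context (X0 : forall k A, <<s G k >> A -> (\int[P]_(x in A) (X k x)%:E = 0)%E).
Context (v : nat -> R) (X2 : forall k, (\int[P]_x (X k x ^+ 2)%:E <= (v k)%:E)%E).

Lemma measurable_filtrationS (f : T -> R) k :
  measurable_fun setT (f : g_sigma_algebraType (G k) -> R) ->
  measurable_fun setT (f : g_sigma_algebraType (G k.+1) -> R).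
Proof. by move=> mf _ B mB; apply: ndG; exact: mf. Qed.

(* The partial sums of [X] from time [n] on, frozen when they leave [-e, e]:
   the cross terms in the second moment then have bounded predictable weights. *)
Fixpoint stopped (n : nat) (e : R) (k : nat) (x : T) : R :=
  if k is k'.+1 then
    (if `|stopped n e k' x| <= e then stopped n e k' x + X (n + k')%N x
     else stopped n e k' x)
  else 0.

(** The test for freezing looks at the sum before [X (n + k)] is added, so it is decided by the past
    of that variable. *)
Lemma measurable_stopped n e k :
  measurable_fun setT (stopped n e k : g_sigma_algebraType (G (n + k)) -> R).
Proof.
elim: k => [|k IH]; first exact: measurable_cst.
rewrite addnS; apply: measurable_fun_ifT.
- apply: measurable_fun_ler => //; apply: measurableT_comp => //.
  exact: measurable_filtrationS.
- by apply: measurable_funD; [exact: measurable_filtrationS|exact: mX].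
- exact: measurable_filtrationS.
Qed.

Let v_ge0 k : 0 <= v k.
Proof.
by rewrite -lee_fin; apply: le_trans (X2 k); apply: integral_ge0 => x _; rewrite lee_fin sqr_ge0.
Qed.

Let mXT k : measurable_fun setT (X k).
Proof. exact: (@measurable_g_sigma _ _ _ _ _ _ (@sG k.+1)). Qed.

Let integrable_sqr k : P.-integrable setT (fun x => (X k x ^+ 2)%:E).
Proof.
apply/integrableP; split; first by apply/measurable_EFinP; exact: measurable_funX.
apply: (@le_lt_trans _ _ (v k)%:E); last exact: ltry.
apply: le_trans (X2 k); rewrite le_eqVlt; apply/orP; left; apply/eqP.
by apply: eq_integral => x _; rewrite gee0_abs// lee_fin sqr_ge0.
Qed.

Let integrableX k : P.-integrable setT (EFin \o X k).
Proof.
apply: (@le_integrable _ _ _ _ _ measurableT _ (fun x => (1 + X k x ^+ 2)%:E)).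
- exact/measurable_EFinP.
- move=> x _ /=; rewrite lee_fin [leRHS]ger0_norm; last by have := sqr_ge0 (X k x); lra.
  by rewrite ler_norml; have := sqr_ge0 (X k x - 1); have := sqr_ge0 (X k x + 1); nra.
- under eq_fun do rewrite EFinD.
  apply: integrableD => //; exact: finite_measure_integrable_cst.
Qed.

(** With [S] the stopped sum and [Z] the next variable, the new square is [S^2 + Y Z + J Z^2]. The
    weight [Y], which is [2 S] before freezing and 0 after it, is predictable and bounded by [2 e],
    so the cross term integrates to 0; the last term contributes at most the second moment of
    [Z]. *)
Lemma stopped_second_moment n e k :
  P.-integrable setT (fun x => (stopped n e k x ^+ 2)%:E) /\
  (\int[P]_x (stopped n e k x ^+ 2)%:E <= (\sum_(t < k) v (n + t)%N)%:E)%E.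
Proof.
elim: k => [|k [IH1 IH2]].
  rewrite big_ord0 /=; under eq_fun do rewrite expr0n/=.
  split; first exact: integrable0.
  by rewrite integral0_eq.
set S := stopped n e k in IH1 IH2 *; pose Z := X (n + k)%N.
have mZ : measurable_fun setT Z by exact: mXT.
pose J x : R := if `|S x| <= e then 1 else 0.
pose Y x : R := if `|S x| <= e then 2 * S x else 0.
have mS : measurable_fun setT (S : g_sigma_algebraType (G (n + k)) -> R).
  exact: measurable_stopped.
have mST : measurable_fun setT S by apply: (@measurable_g_sigma _ _ _ _ _ _ (@sG (n + k)%N)).
have mb : measurable_fun setT ((fun x => `|S x| <= e) : g_sigma_algebraType (G (n + k)) -> bool).
  by apply: measurable_fun_ler => //; exact: measurableT_comp.
have mY : measurable_fun setT (Y : g_sigma_algebraType (G (n + k)) -> R).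
  by apply: measurable_fun_ifT => //; exact: measurable_funM.
have mYT : measurable_fun setT Y by apply: (@measurable_g_sigma _ _ _ _ _ _ (@sG (n + k)%N)).
have mJT : measurable_fun setT J.
  apply: measurable_fun_ifT => //; apply: measurable_fun_ler => //.
  exact: measurableT_comp.
have YC x : `|Y x| <= `|2 * e|.
  rewrite /Y; case: ifPn => h; last by rewrite normr0.
  by rewrite !normrM ler_wpM2l//; exact: le_trans (ler_norm e).
have iYZ : P.-integrable setT (EFin \o (fun x => Y x * Z x)).
  apply: (@integrable_bounded_mul _ _ _ P Z Y (`|2 * e|)) => //; exact: integrableX.
have iJZ : P.-integrable setT (EFin \o (fun x => J x * Z x ^+ 2)).
  apply: (@integrable_bounded_mul _ _ _ P (fun x => Z x ^+ 2) J 1) => //;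
    last exact: integrable_sqr.
  by move=> x; rewrite /J; case: ifP; rewrite ?normr1 ?normr0.
have E : (fun x => (stopped n e k.+1 x ^+ 2)%:E) =
    (fun x => (S x ^+ 2)%:E + ((Y x * Z x)%:E + (J x * Z x ^+ 2)%:E))%E.
  apply/funext => x; rewrite -!EFinD /= -/S -/Z /Y /J; congr EFin; case: ifP => _; ring.
have iYJ : P.-integrable setT (fun x => ((Y x * Z x)%:E + (J x * Z x ^+ 2)%:E)%E).
  exact: integrableD.
rewrite E; split; first exact: integrableD.
rewrite integralD// big_ord_recr/= EFinD; apply: leeD => //.
have YZ0 : (\int[P]_x (Y x * Z x)%:E = 0)%E.
  apply: (@integral_bounded_weight _ _ _ P _ (@sG (n + k)%N) Z Y (`|2 * e|)) => //.
    exact: integrableX.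
  exact: X0.
rewrite integralD// YZ0 add0e; apply: le_trans (X2 (n + k)%N); apply: ge0_le_integral => //.
- by move=> x _; rewrite lee_fin /J; case: ifP => _; rewrite ?mul1r ?mul0r ?sqr_ge0.
- by apply/measurable_EFinP; apply: measurable_funM => //; exact: measurable_funX.
- by apply/measurable_EFinP; exact: measurable_funX.
- by move=> x _; rewrite lee_fin /J; case: ifP => _; rewrite ?mul1r ?mul0r ?sqr_ge0.
Qed.

Let measurable_exit n e k : measurable [set x | e < `|stopped n e k x|].
Proof.
have mS : measurable_fun setT (stopped n e k).
  apply: (@measurable_g_sigma _ _ _ _ _ _ (@sG (n + k)%N)); exact: measurable_stopped.
by apply: measurable_set_lt => //; exact: measurableT_comp.
Qed.

Lemma stopped_exit_prob n e k : 0 < e ->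
  (P [set x | (e < `|stopped n e k x|)%R] <= (e ^- 2 * \sum_(t < k) v (n + t)%N)%:E)%E.
Proof.
move=> e0; have [iS S2] := stopped_second_moment n e k.
have mS : measurable_fun setT (stopped n e k).
  apply: (@measurable_g_sigma _ _ _ _ _ _ (@sG (n + k)%N)); exact: measurable_stopped.
have mg : measurable_fun setT (fun x => (stopped n e k x ^+ 2)%:E).
  by apply/measurable_EFinP; exact: measurable_funX.
have e20 : 0 < e ^+ 2 by rewrite exprn_gt0.
have := @le_integral_abse _ _ _ P _ measurableT _ _ mg e20.
rewrite setTI; under [X in (_ <= X)%E]eq_integral do rewrite gee0_abs ?lee_fin ?sqr_ge0//.
move=> /le_trans/(_ S2) H.
rewrite EFinM -lee_pdivrMl ?invr_gt0//.
  rewrite invrK; apply: le_trans H; apply: lee_wpmul2l; first by rewrite lee_fin ltW.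
  apply: le_measure; rewrite ?inE.
  - exact: measurable_exit.
  - have mb : measurable_fun setT (fun x => ((e ^+ 2)%:E <= `|(stopped n e k x ^+ 2)%:E|)%E).
      by apply: measurable_fun_lee => //; exact: measurableT_comp.
    by rewrite -[X in measurable X]setTI; exact: (mb measurableT [set true]).
  - move=> x /= ex; rewrite lee_fin ger0_norm ?sqr_ge0// -(real_normK (num_real (stopped n e k x))).
    by rewrite lerXn2r ?nnegrE ?normr_ge0 ?ltW.
Qed.

(** A sum that has left [[-e, e]] is frozen outside it. The Chebyshev bound at one time therefore
    covers every earlier exit, which gives a maximal inequality of Kolmogorov type. *)
Lemma stopped_exit_nd n e : 
  {homo (fun k => [set x | e < `|stopped n e k x|]) : i j / (i <= j)%N >-> (i <= j)%O}.
Proof.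
apply/nondecreasing_seqP => k; apply/subsetPset => x /= ex.
by rewrite leNgt ex/=.
Qed.

Lemma stopped_stay n e x : (forall k, `|stopped n e k x| <= e) ->
  forall k, `|\sum_(t < k) X (n + t)%N x| <= e.
Proof.
move=> h k; suff <- : stopped n e k x = \sum_(t < k) X (n + t)%N x by [].
by elim: k => [|k IH]; [rewrite big_ord0|rewrite big_ord_recr/= h IH].
Qed.

(** By the Cauchy criterion, a divergent outcome has a radius that the series leaves however late it
    is restarted. For a fixed radius the probability of leaving after a restart at [n] is controlled
    by the tail of [v] from [n] on, which can be made arbitrarily small. *)
Lemma martingale_series_cvg : (exists B, forall k, \sum_(t < k) v t <= B) ->
  {ae P, forall x, cvgn (fun k => \sum_(t < k) X t x)}.
Proof.
move=> vB.
pose bad n e := \bigcup_k [set x | e < `|stopped n e k x|].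
have mbad n e : measurable (bad n e) by apply: bigcup_measurable => k _; exact: measurable_exit.
have small (e r : R) : 0 < e -> 0 < r -> exists n, (P (bad n e) <= r%:E)%E.
  (* The tail is made smaller than [e^2 * r] because the Chebyshev bound divides it by [e^2]. *)
  move=> e0 r0; have er0 : 0 < e ^+ 2 * r by rewrite mulr_gt0 ?exprn_gt0.
  have [n vn] := bounded_partial_sums_tail v_ge0 vB er0; exists n.
  have c : P [set x | e < `|stopped n e k x|] @[k --> \oo] --> P (bad n e).
    apply: nondecreasing_cvg_mu => [k||]; [exact: measurable_exit|exact: mbad|].
    exact: stopped_exit_nd.
  rewrite -(cvg_lim _ c)//; apply: lime_le; first by apply/cvg_ex; eexists; exact: c.
  exists 0%N => // k _ /=; apply: le_trans (stopped_exit_prob _ _ e0) _.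
  by rewrite lee_fin mulrC ler_pdivrMr ?exprn_gt0// mulrC.
(* The radii [1 / (j + 1)] suffice, which makes the exceptional set a countable union of null
   sets. *)
pose N j := \bigcap_n bad n (j.+1%:R^-1 : R).
apply: (@negligibleS _ _ _ _ (\bigcup_j N j)); last first.
  apply: negligible_bigcup => j; exists (N j); split => //.
    exact: bigcap_measurableType.
  apply/eqP; rewrite eq_le measure_ge0 andbT; apply/lee_addgt0Pr => r r0.
  have [n Pn] := small j.+1%:R^-1 r ltac:(by rewrite invr_gt0) r0.
  rewrite add0e; apply: le_trans Pn; apply: le_measure; rewrite ?inE//.
    exact: bigcap_measurableType.
  by move=> x; exact.
move=> x /=; apply: contra_notP => nN.
apply: cauchy_cvg; apply: cauchy_exP => e e0.
have [j je] : exists j : nat, j.+1%:R^-1 < e.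
  have /cvgrPdist_lt/(_ _ e0)[j _ /(_ j (leqnn j))/=] := @cvg_harmonic R.
  by rewrite sub0r normrN ger0_norm ?invr_ge0// => ?; exists j.
have [n nbad] : exists n, ~ bad n (j.+1%:R^-1 : R) x.
  by apply/existsNP => h; apply: nN; exists j => // n _; exact: h.
have st k : `|stopped n j.+1%:R^-1 k x| <= j.+1%:R^-1.
  by rewrite leNgt; apply/negP => h; apply: nbad; exists k.
exists (\sum_(t < n) X t x); exists n => // k /= nk.
rewrite /ball/= distrC (le_lt_trans _ je)//.
have [m ->] : exists m, k = (n + m)%N by exists (k - n)%N; rewrite subnKC.
by rewrite big_split_ord/= addrAC subrr add0r; exact: stopped_stay.
Qed.

End MartingaleConvergence.

(** * Independent dither *)

Section Freezing.
Context (d : measure_display) (T : measurableType d) (R : realType).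
Context (P : probability T R) (G : set (set T)) (sG : G `<=` measurable).
Context (D : T -> R) (mD : measurable_fun setT D).
Context (indep : forall A B, <<s G >> A -> measurable B ->
  P (A `&` D @^-1` B) = (P A * P (D @^-1` B))%E).

Let idG (x : T) : g_sigma_algebraType G := x.
Let m_idG : measurable_fun setT idG.
Proof. by move=> _ B mB; rewrite setTI; exact: (sub_g_sigma sG). Qed.
Let m_pair : measurable_fun setT (fun x => (idG x, D x)).
Proof. exact: measurable_fun_pair. Qed.
Let fid : {mfun T >-> g_sigma_algebraType G} :=
  HB.pack idG (isMeasurableFun.Build _ _ _ _ _ m_idG).
Let fD : {mfun T >-> R} := HB.pack D (isMeasurableFun.Build _ _ _ _ _ mD).
Let fpair : {mfun T >-> (g_sigma_algebraType G * R)%type} :=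
  HB.pack (fun x => (idG x, D x)) (isMeasurableFun.Build _ _ _ _ _ m_pair).

(** The outcome seen through [G] is itself a random element, namely the identity into
    [g_sigma_algebraType G]. Independence makes its joint law with [D] a product measure, and the
    measure of [E] is then obtained by integrating over sections, that is with the past held
    fixed. *)
Lemma freezing (E : set (g_sigma_algebraType G * R)) : measurable E ->
  P [set x : T | E (x, D x)] = (\int[P]_x P (D @^-1` xsection E x))%E.
Proof.
move=> mE.
have H : (distribution P fid \x distribution P fD)%E E = distribution P fpair E.
  by apply: product_measure_unique => // A B mA mB; exact: indep.
rewrite -[LHS]/(distribution P fpair E) -H /product_measure1 ge0_integral_pushforward//.
exact: measurable_fun_xsection.
Qed.

Context (D_lap : forall x, P [set om | D om <= x] = (lap_cdf x)%:E).

Let measurable_le_D y : measurable [set om | D om <= y].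
Proof.
rewrite -[X in measurable X]setTI; apply: (mD measurableT (Y := [set u | u <= y])).
by rewrite [X in measurable X](_ : _ = `]-oo, y]%classic)// set_itvE.
Qed.

Lemma prob_gt_lap y : P (D @^-1` [set u | y < u]) = (lap_cdf (- y))%:E.
Proof.
have -> : D @^-1` [set u | y < u] = ~` [set om | D om <= y].
  by apply/seteqP; split => x /=; rewrite ltNge => /negP.
by rewrite probability_setC ?D_lap ?lap_cdfN ?EFinB//; exact: measurable_le_D.
Qed.

(** The law is prescribed on closed half-lines; that a strict inequality has the same probability
    means that there is no atom at [y], which follows from the Lipschitz bound. *)
Lemma prob_lt_lap y : P (D @^-1` [set u | u < y]) = (lap_cdf y)%:E.
Proof.
have mlt : measurable (D @^-1` [set u | u < y]).
  rewrite -[X in measurable X]setTI; apply: mD => //.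
  by rewrite [X in measurable X](_ : _ = `]-oo, y[%classic)// set_itvE.
apply/eqP; rewrite eq_le; apply/andP; split.
  by rewrite -D_lap; apply: le_measure; rewrite ?inE// => om /= /ltW.
apply/lee_addgt0Pr => e e0.
have := @lap_cdf_lip _ (y - e) y; rewrite gerBl ltW// => /(_ isT) /andP[_ he].
apply: (@le_trans _ _ (lap_cdf (y - e) + e)%:E); first by rewrite lee_fin; lra.
rewrite EFinD leeD2r// -D_lap; apply: le_measure; rewrite ?inE// => om /=; lra.
Qed.

Context (x : g_sigma_algebraType G -> R) (mx : measurable_fun setT x) (b c : R) (b0 : 0 < b).

Let measurable_affine : measurable_fun setT
  (fun q : g_sigma_algebraType G * R => x q.1 + b * q.2).
Proof.
apply: measurable_funD; first exact: measurableT_comp.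
by apply: measurable_funM.
Qed.

Let measurable_fst (A : set T) : <<s G >> A ->
  measurable [set q : g_sigma_algebraType G * R | A q.1].
Proof.
move=> mA; rewrite -[X in measurable X]setTI.
exact: (@measurable_fst _ _ (g_sigma_algebraType G) R measurableT A).
Qed.

(** For an outcome in [A], the section of the event is the half-line above [(c - x) / b], whose
    Laplace probability is [lap_cdf ((x - c) / b)] by symmetry. *)
Lemma prob_dither_gt A : <<s G >> A ->
  P (A `&` [set om : T | c < x om + b * D om]) = (\int[P]_(om in A) (lap_cdf ((x om - c) /
    b))%:E)%E.
Proof.
move=> mA.
pose E := [set q : g_sigma_algebraType G * R | A q.1] `&` [set q | c < x q.1 + b * q.2].
have mE : measurable E.
  apply: measurableI; first exact: measurable_fst.
  exact: measurable_set_lt.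
have := freezing mE; rewrite [X in P X = _](_ : _ = A `&` [set om : T | c < x om + b * D om])//
  => ->.
rewrite [RHS]integral_mkcond; apply: eq_integral => om _; rewrite patchE.
case: ifPn => [|]; rewrite ?inE ?notin_setE => Aom.
  have -> : (x om - c) / b = - ((c - x om) / b) by field; rewrite gt_eqF.
  rewrite -prob_gt_lap; congr (P (D @^-1` _)); apply/seteqP; split => u /=;
    rewrite /xsection/= inE /E/=.
    by move=> [_]; rewrite ltr_pdivrMr//; lra.
  by rewrite ltr_pdivrMr// => h; split => //; lra.
rewrite [X in P (D @^-1` X)](_ : _ = set0) ?preimage_set0 ?measure0//.
by apply/seteqP; split => u //=; rewrite /xsection/= inE => -[].
Qed.

Lemma prob_dither_lt A : <<s G >> A ->
  P (A `&` [set om : T | x om + b * D om < - c]) = (\int[P]_(om in A) (lap_cdf ((- x om - c) /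
    b))%:E)%E.
Proof.
move=> mA.
pose E := [set q : g_sigma_algebraType G * R | A q.1] `&` [set q | x q.1 + b * q.2 < - c].
have mE : measurable E.
  apply: measurableI; first exact: measurable_fst.
  exact: measurable_set_lt.
have := freezing mE; rewrite [X in P X = _](_ : _ = A `&` [set om : T | x om + b * D om < - c])//
  => ->.
rewrite [RHS]integral_mkcond; apply: eq_integral => om _; rewrite patchE.
case: ifPn => [|]; rewrite ?inE ?notin_setE => Aom.
  rewrite -prob_lt_lap; congr (P (D @^-1` _)); apply/seteqP; split => u /=;
    rewrite /xsection/= inE /E/=.
    by move=> [_]; rewrite ltr_pdivlMr//; lra.
  by rewrite ltr_pdivlMr// => h; split => //; lra.
rewrite [X in P (D @^-1` X)](_ : _ = set0) ?preimage_set0 ?measure0//.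
by apply/seteqP; split => u //=; rewrite /xsection/= inE => -[].
Qed.

Context (c0 : 0 <= c).

(** This is the value $\hat s$ held by the receiver, as a function of the dithered value at the
    sender; 0 encodes that no message was sent. *)
Definition quantized (u : R) : R := if c < `|u| then (if 0 < u then 1 else -1) else 0.

(** Since [c >= 0], the events [U] and [L] are disjoint and the message is the difference of their
    indicators; each indicator has the conditional mean computed just before. *)
Lemma integral_dither A : <<s G >> A ->
  (\int[P]_(om in A) (quantized (x om + b * D om) -
     (lap_cdf ((x om - c) / b) - lap_cdf ((- x om - c) / b)))%:E = 0)%E.
Proof.
move=> mA; have mAT : measurable A by exact: (sub_g_sigma sG).
have mxT : measurable_fun setT (x : T -> R) by exact: measurable_g_sigma.
have maff : measurable_fun setT (fun om : T => x om + b * D om).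
  by apply: measurable_funD => //; exact: measurable_funM.
set U := [set om : T | c < x om + b * D om].
set L := [set om : T | x om + b * D om < - c].
have mU : measurable U by exact: measurable_set_lt.
have mL : measurable L by exact: measurable_set_lt.
pose g1 (om : T) := lap_cdf ((x om - c) / b).
pose g2 (om : T) := lap_cdf ((- x om - c) / b).
have mg1 : measurable_fun setT g1.
  apply: measurableT_comp; first exact: measurable_lap_cdf.
  by apply: measurable_funM => //; exact: measurable_funB.
have mg2 : measurable_fun setT g2.
  apply: measurableT_comp; first exact: measurable_lap_cdf.
  by apply: measurable_funM => //; apply: measurable_funB => //; exact: measurableT_comp.
have iB (f : T -> R) : measurable_fun setT f -> (forall om, 0 <= f om <= 1) ->
    P.-integrable A (EFin \o f).
  move=> mf f1; apply: (integrableS measurableT) => //.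
  rewrite (_ : EFin \o f = (fun om => (f om * 1)%:E)); last first.
    by apply/funext => om; rewrite mulr1.
  apply: (@integrable_bounded_mul _ _ _ P (cst 1) f 1) => //.
    by move=> om; rewrite ger0_norm; case/andP: (f1 om).
  exact: finite_measure_integrable_cst.
have iU : P.-integrable A (EFin \o \1_U).
  by apply: iB => // om; rewrite indicE; case: (_ \in _); rewrite lexx ler01.
have iL : P.-integrable A (EFin \o \1_L).
  by apply: iB => // om; rewrite indicE; case: (_ \in _); rewrite lexx ler01.
have i1 : P.-integrable A (EFin \o g1).
  by apply: iB => // om; rewrite lap_cdf_ge0 lap_cdf_le1.
have i2 : P.-integrable A (EFin \o g2).
  by apply: iB => // om; rewrite lap_cdf_ge0 lap_cdf_le1.
have e1 : (\int[P]_(om in A) (EFin \o \1_U) om = \int[P]_(om in A) (EFin \o g1) om)%E.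
  by rewrite integral_indic// setIC; exact: prob_dither_gt.
have e2 : (\int[P]_(om in A) (EFin \o \1_L) om = \int[P]_(om in A) (EFin \o g2) om)%E.
  by rewrite integral_indic// setIC; exact: prob_dither_lt.
transitivity (\int[P]_(om in A) (((EFin \o \1_U) om - (EFin \o \1_L) om) -
    ((EFin \o g1) om - (EFin \o g2) om)))%E.
  apply: eq_integral => om _; rewrite /= -!EFinB; congr EFin; congr (_ - _).
  rewrite /quantized !indicE.
  have -> : (om \in U) = (c < x om + b * D om) by apply/idP/idP; rewrite inE.
  have -> : (om \in L) = (x om + b * D om < - c) by apply/idP/idP; rewrite inE.
  set u := x om + _; case: (ltP c u) => cu; case: (ltP u (- c)) => uc.
  - by exfalso; move: c0 cu uc; lra.
  - rewrite ger0_norm ?cu; last by move: c0 cu; lra.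
    by rewrite subr0 ifT//; move: c0 cu; lra.
  - rewrite ler0_norm; last by move: c0 cu uc; lra.
    rewrite sub0r ifT; last by move: uc; lra.
    by rewrite ifF//; apply/negbTE; rewrite -leNgt; move: c0 uc; lra.
  - rewrite (_ : (c < `|u|) = false); first by rewrite subrr.
    by apply/negbTE; rewrite -leNgt ler_norml; lra.
rewrite integralB//; [|exact: integrableB|exact: integrableB].
by rewrite !integralB// e1 e2 subee// fin_numB !integrable_fin_num.
Qed.

End Freezing.

(** * Independence of the next dither from the past *)

Section Filtration.
Context (dsp : measure_display) (Omega : measurableType dsp) (R : realType).
Context (P : probability Omega R) (N : nat) (m : 'I_N -> nat).
Context (w : forall i : 'I_N, nat -> Omega -> 'cV[R]_(m i)) (d : 'I_N -> nat -> Omega -> R).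
Context (w_meas : forall i k (c : 'I_(m i)), (1 <= k)%N ->
     measurable_fun setT (fun om => w i k om c 0)).
Context (d_meas : forall i k, (1 <= k)%N -> measurable_fun setT (d i k)).

Definition gen_wd (k : nat) : set (set Omega) := gen_w w k `|` gen_d d k.

Lemma gen_w_measurable k : gen_w w k `<=` measurable.
Proof.
move=> _ [i [t [c [B [/andP[t1 _] [mB ->]]]]]].
by rewrite -[X in measurable X]setTI; exact: w_meas.
Qed.

Lemma gen_d_measurable k : gen_d d k `<=` measurable.
Proof.
move=> _ [i [t [B [/andP[t1 _] [mB ->]]]]].
by rewrite -[X in measurable X]setTI; exact: d_meas.
Qed.

Lemma gen_wd_measurable k : gen_wd k `<=` measurable.
Proof. by move=> A [/gen_w_measurable|/gen_d_measurable]. Qed.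

Lemma gen_wd_nd k : <<s gen_wd k >> `<=` <<s gen_wd k.+1 >>.
Proof.
apply: sub_smallest2r => // A [] [i [t h]]; [left|right]; exists i, t.
  case: h => c [B [/andP[t1 tk] h]]; exists c, B; split => //.
  by rewrite t1 (leq_trans tk).
case: h => B [/andP[t1 tk] h]; exists B; split => //.
by rewrite t1 (leq_trans tk).
Qed.

Lemma measurable_w_gen i k (c : 'I_(m i)) : (1 <= k)%N ->
  measurable_fun setT ((fun om => w i k om c 0) : g_sigma_algebraType (gen_wd k) -> R).
Proof.
move=> k1 _ B mB; rewrite setTI; apply: sub_sigma_algebra; left.
by exists i, k, c, B; rewrite k1 leqnn.
Qed.

Lemma measurable_d_gen i k : (1 <= k)%N ->
  measurable_fun setT (d i k : g_sigma_algebraType (gen_wd k) -> R).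
Proof.
move=> k1 _ B mB; rewrite setTI; apply: sub_sigma_algebra; right.
by exists i, k, B; rewrite k1 leqnn.
Qed.

Context (d_indep : forall (s : seq ('I_N * nat)) (B : 'I_N -> nat -> set R) (A : set Omega),
     uniq s -> all (fun q => (1 <= q.2)%N) s ->
     (forall i k, measurable (B i k)) -> <<s gen_w_all w >> A ->
     P (A `&` \big[setI/setT]_(q <- s) (d q.1 q.2 @^-1` B q.1 q.2))
     = (P A * \prod_(q <- s) P (d q.1 q.2 @^-1` B q.1 q.2))%E).

(** The independence assumption concerns an event of [w] intersected with finitely many conditions
    on single dithers. Such intersections form a pi-system that generates the past at time [k], and
    uniqueness of measures extends the product formula to that whole past. *)
Lemma dither_indep k j A B : <<s gen_wd k >> A -> measurable B ->
  P (A `&` d j k.+1 @^-1` B) = (P A * P (d j k.+1 @^-1` B))%E.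
Proof.
move=> GA mB.
pose s := [seq (i, t) | i <- enum 'I_N, t <- iota 1 k].
have in_s i t : ((i, t) \in s) = (1 <= t <= k)%N.
  apply/allpairsP/idP => [[[i' t'] /= [_ + [_ ->]]]|tk]; first by rewrite mem_iota add1n ltnS.
  by exists (i, t); rewrite mem_enum mem_iota add1n ltnS.
have us : uniq s by rewrite allpairs_uniq ?enum_uniq ?iota_uniq// => -[? ?] [? ?].
have s1 : all (fun q => (1 <= q.2)%N) s.
  by apply/allP => -[i t]; rewrite in_s => /andP[].
pose cyl (Bf : 'I_N -> nat -> set R) :=
  \big[setI/setT]_(q <- s) (d q.1 q.2 @^-1` Bf q.1 q.2).
pose Pi := [set A | exists Aw Bf, [/\ <<s gen_w_all w >> Aw,
  forall i t, measurable (Bf i t) & A = Aw `&` cyl Bf]].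
have swm : gen_w_all w `<=` measurable by move=> C [t _]; exact: gen_w_measurable.
have mcyl Bf : (forall i t, measurable (Bf i t)) -> measurable (cyl Bf).
  move=> mBf; rewrite /cyl big_seq; apply: (big_ind measurable) => //.
    exact: measurableI.
  move=> [i t]; rewrite in_s => /andP[t1 _] /=.
  by rewrite -[X in measurable X]setTI; exact: d_meas.
have sPi : Pi `<=` measurable.
  move=> _ [Aw [Bf [hAw mBf ->]]]; apply: measurableI; last exact: mcyl.
  exact: (sub_g_sigma swm).
have PiI : setI_closed Pi.
  move=> _ _ [A1 [B1 [h1 m1 ->]]] [A2 [B2 [h2 m2 ->]]].
  exists (A1 `&` A2), (fun i t => B1 i t `&` B2 i t); split.
  - exact: (@measurableI _ (g_sigma_algebraType (gen_w_all w))).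
  - by move=> i t; exact: measurableI.
  - rewrite setIACA; congr (_ `&` _); rewrite /cyl -big_split/=.
    by apply: eq_bigr => q _; rewrite preimage_setI.
have wT : <<s gen_w_all w >> setT by exact: (@measurableT _ (g_sigma_algebraType (gen_w_all w))).
have PiT : Pi setT.
  exists setT, (fun _ _ => setT); split => //.
  by rewrite setTI /cyl big1.
have genPi : gen_wd k `<=` Pi.
  move=> C [hC|[i [t [B' [tk [mB' ->]]]]]].
    exists C, (fun _ _ => setT); split => //.
      by apply: sub_sigma_algebra; exists k.
    by rewrite /cyl big1 ?setIT.
  exists setT, (fun i' t' => if (i', t') == (i, t) then B' else setT); split => //.
    by move=> i' t'; case: ifP.
  rewrite setTI /cyl (bigD1_seq (i, t)) ?in_s//= eqxx big1 ?setIT// => -[i' t'] /= /negbTE ->.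
  exact: preimage_setT.
have mD : measurable (d j k.+1 @^-1` B) by rewrite -[X in measurable X]setTI; exact: d_meas.
pose p := fine (P (d j k.+1 @^-1` B)).
have pE : P (d j k.+1 @^-1` B) = p%:E by rewrite fineK ?fin_num_measure.
have p0 : 0 <= p by rewrite fine_ge0.
(* Both sides are finite measures in [A]: the restriction of [P] to the event of the new dither, and
   [P] scaled by the probability of that event. *)
suff H : mrestr P mD A = mscale (NngNum p0) P A.
  by rewrite -[LHS]/(mrestr P mD A) H pE muleC.
apply: (@g_sigma_algebra_measure_unique _ R _ Pi sPi (fun=> setT)) => //.
- by apply: bigcup_const; exists 0%N.
- move=> _ [Aw [Bf [hAw mBf ->]]].
  (* The condition on [d j k.+1] is added to the cylinder; its index is fresh because [s] only
     contains times up to [k]. *)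
  pose B' i t := if (i, t) == (j, k.+1) then B else Bf i t.
  have mB' i t : measurable (B' i t) by rewrite /B'; case: ifP.
  have e q : q \in s -> B' q.1 q.2 = Bf q.1 q.2.
    case: q => i t; rewrite in_s /B' /= => /andP[_ tk]; case: eqP => // -[_ tk'].
    by rewrite tk' ltnn in tk.
  have us' : uniq ((j, k.+1) :: s) by rewrite /= us in_s ltnn andbF.
  have := d_indep us' _ mB' hAw; rewrite /= s1 => /(_ isT).
  rewrite !big_cons /= [B' j k.+1]/B' eqxx.
  under eq_big_seq do rewrite e//.
  under [X in (_ * (_ * X))%E]eq_big_seq do rewrite e//.
  rewrite /mrestr /mscale/= -setIA [cyl Bf `&` _]setIC -pE => ->.
  by rewrite d_indep// muleCA.
- move=> _; rewrite -[X in (X < _)%E]/(P (setT `&` d j k.+1 @^-1` B)) setTI.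
  by rewrite (le_lt_trans (probability_le1 _ mD)) ?ltry.
- exact: (sub_smallest2r (smallest_sigma_algebra _ _) genPi GA).
Qed.

End Filtration.

(** * Deterministic sequences *)

Section RealSequences.
Context (R : realType).

Lemma cvgn_abs_bounded (u : nat -> R) : cvgn u -> exists B, forall k, `|u k| <= B.
Proof.
move=> /cvg_seq_bounded [B [_ h]]; exists (B + 1) => k.
by apply: (h (B + 1)) => //; rewrite ltrDl.
Qed.

Lemma cvgn_big_sum (I : Type) (r : seq I) (u : I -> nat -> R) :
  (forall i, cvgn (u i)) -> cvgn (fun k => \sum_(i <- r) u i k).
Proof.
move=> h; apply/cvg_ex; exists (\sum_(i <- r) limn (u i)).
by apply: cvg_big => [|i _]; [exact: add_continuous|exact: h].
Qed.

Lemma bounded_partial_sums_cvg (v : nat -> R) : (forall k, 0 <= v k) ->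
  (exists B, forall k, \sum_(t < k) v t <= B) -> cvgn (fun k => \sum_(t < k) v t).
Proof.
move=> v0 [B vB]; apply: nondecreasing_is_cvgn; last by exists B => _ [k _ <-].
by apply/nondecreasing_seqP => k; rewrite big_ord_recr/= lerDl.
Qed.

Lemma bounded_partial_sums_to0 (v : nat -> R) : (forall k, 0 <= v k) ->
  (exists B, forall k, \sum_(t < k) v t <= B) -> v k @[k --> \oo] --> (0 : R).
Proof.
move=> v0 vB; have := bounded_partial_sums_cvg v0 vB => c.
pose S k := \sum_(t < k) v t.
have h : S @ \oo --> limn S := c.
have H : S k.+1 - S k @[k --> \oo] --> limn S - limn S.
  by apply: cvgB => //; move: h; rewrite -cvg_shiftS.
have E : (fun k => S k.+1 - S k) = v.
  by apply/funext => k; rewrite /S big_ord_recr/= addrAC subrr add0r.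
by rewrite subrr E in H.
Qed.

Lemma bounded_finite_sums (I : finType) (u : I -> nat -> R) :
  (forall i, exists B, forall k, \sum_(t < k) u i t <= B) ->
  exists B, forall k, \sum_(t < k) \sum_i u i t <= B.
Proof.
move=> /choice[B hB]; exists (\sum_i B i) => k.
by rewrite exchange_big/=; apply: ler_sum => i _; exact: hB.
Qed.

Lemma bounded_partial_sums_le (u v : nat -> R) (c : R) : 0 <= c ->
  (forall k, u k <= c * v k) -> (exists B, forall k, \sum_(t < k) v t <= B) ->
  exists B, forall k, \sum_(t < k) u t <= B.
Proof.
move=> c0 uv [B hB]; exists (c * B) => k.
apply: (@le_trans _ _ (\sum_(t < k) c * v t)); first by apply: ler_sum => t _; exact: uv.
by rewrite -mulr_sumr ler_wpM2l.
Qed.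

Lemma bounded_partial_sumsZ (v : nat -> R) (c : R) : 0 <= c ->
  (exists B, forall k, \sum_(t < k) v t <= B) -> exists B, forall k, \sum_(t < k) c * v t <= B.
Proof. by move=> c0 [B hB]; exists (c * B) => k; rewrite -mulr_sumr ler_wpM2l. Qed.

Lemma bounded_partial_sumsD (u v : nat -> R) :
  (exists B, forall k, \sum_(t < k) u t <= B) -> (exists B, forall k, \sum_(t < k) v t <= B) ->
  exists B, forall k, \sum_(t < k) (u t + v t) <= B.
Proof.
move=> [B hB] [C hC]; exists (B + C) => k; by rewrite big_split; exact: (lerD (hB k) (hC k)).
Qed.

(* Passing to [ln (1 + V)] turns the multiplicative perturbation into additive
   ones, all of which are summable. *)
Lemma almost_supermartingale_cvg (V D M r : nat -> R) :
  (forall k, 0 <= V k) -> (forall k, 0 <= D k) -> (forall k, 0 <= r k) ->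
  (forall k, V k.+1 <= V k - 2 * D k + 2 * M k + r k * (1 + V k)) ->
  cvgn (fun k => \sum_(t < k) M t / (1 + V t)) ->
  (exists B, forall k, \sum_(t < k) r t <= B) ->
  cvgn V /\ exists B, forall k, \sum_(t < k) D t <= B.
Proof.
move=> V0 D0 r0 step cM rB.
pose L k := ln (1 + V k); pose m k := \sum_(t < k) M t / (1 + V t).
pose s k := \sum_(t < k) r t; pose e k := \sum_(t < k) D t / (1 + V t).
have V1 k : 0 < 1 + V k by apply: ltr_pwDl.
have L0 k : 0 <= L k by apply: ln_ge0; rewrite lerDl.
have stepL k : L k.+1 <= L k - 2 * (D k / (1 + V k)) + 2 * (M k / (1 + V k)) + r k.
  (* This is [ln u <= u - 1] for the ratio [u] of consecutive values of [1 + V]. *)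
  have : L k.+1 - L k <= (1 + V k.+1) / (1 + V k) - 1.
    rewrite /L -ln_div ?posrE//.
    rewrite -[X in ln X](subrKC 1); apply: le_ln1Dx.
    by rewrite ltrBrDl subrr divr_gt0.
  have := step k.
  have vn0 : 1 + V k != 0 by rewrite gt_eqF.
  have -> : (1 + V k.+1) / (1 + V k) = 1 + (V k.+1 - V k) / (1 + V k) by field.
  set q := (V k.+1 - V k) / (1 + V k) => h1 h2.
  suff : q <= - 2 * (D k / (1 + V k)) + 2 * (M k / (1 + V k)) + r k by lra.
  rewrite ler_pdivrMr//.
  have -> : (- 2 * (D k / (1 + V k)) + 2 * (M k / (1 + V k)) + r k) * (1 + V k) =
    - 2 * D k + 2 * M k + r k * (1 + V k) by field.
  lra.
have [Bm hm] := cvgn_abs_bounded cM; have [Bs hs] := rB.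
have main k : L k + 2 * e k <= L 0%N + 2 * m k + s k.
  elim: k => [|k IH]; first by rewrite /e /m /s !big_ord0; lra.
  rewrite /e /m /s !big_ord_recr/= -/(e k) -/(m k) -/(s k).
  by have := stepL k; lra.
pose B := L 0%N + 2 * Bm + Bs.
have mB k : m k <= Bm by apply: le_trans (ler_norm _) (hm k).
have mBN k : - Bm <= m k by have := hm k; rewrite ler_norml => /andP[].
have e0 k : 0 <= e k by apply: sumr_ge0 => t _; rewrite divr_ge0// ltW.
have LB k : L k <= B by have := main k; have := mB k; have := hs k; have := e0 k; rewrite /B /s;
  lra.
have eB k : 2 * e k <= B by have := main k; have := mB k; have := hs k; have := L0 k;
  rewrite /B /s; lra.
have VE k : 1 + V k = expR (L k) by rewrite /L lnK ?posrE.
split.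
  have cs : cvgn s by exact: bounded_partial_sums_cvg.
  (* Subtracting the two convergent series from [L] leaves a nonincreasing sequence that is bounded
     below, so [L] converges too. *)
  have cU : cvgn (fun k => L k - 2 * m k - s k).
    apply: nonincreasing_is_cvgn; last first.
      exists (- 2 * Bm - Bs) => _ [k _ <-]; have := L0 k; have := mB k; have := hs k;
        rewrite /s; lra.
    apply/nonincreasing_seqP => k; rewrite /m /s !big_ord_recr/= -/(m k) -/(s k).
    have : 0 <= D k / (1 + V k) by rewrite divr_ge0// ltW.
    by have := stepL k; lra.
  have cL : cvgn L.
    have -> : L = (fun k => (L k - 2 * m k - s k) + (2 * m k + s k)).
      by apply/funext => k; ring.
    apply: is_cvgD => //; apply: is_cvgD => //; apply: is_cvgM => //; exact: is_cvg_cst.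
  have -> : V = (fun k => expR (L k) - 1).
    by apply/funext => k; rewrite -VE; ring.
  apply: is_cvgB; last exact: is_cvg_cst.
  apply/cvg_ex; exists (expR (limn L)).
  by apply: continuous_cvg => //; exact: continuous_expR.
(* As [1 + V t <= expR B], passing from [D t / (1 + V t)] back to [D t] costs a factor [expR B]; the
   quotients sum to at most [B / 2]. *)
exists (expR B * B / 2) => k.
have : \sum_(t < k) D t <= \sum_(t < k) expR B * (D t / (1 + V t)).
  apply: ler_sum => t _; rewrite mulrCA ler_peMr//.
  by rewrite ler_pdivlMr// mul1r VE ler_expR.
rewrite -mulr_sumr -/(e k) => /le_trans; apply.
by rewrite -mulrA ler_wpM2l ?expR_ge0// ler_pdivlMr// mulrC.
Qed.

(** If the limit were positive, every late window would carry at least a fixed amount of energy.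
    Weighting this by [z] and summing, each term [z t * E t] is counted at most [q] times, so the
    sum of [z] would be bounded. *)
Lemma excitation_limit0 (V E eta z : nat -> R) (c C Vinf : R) (q : nat) :
  (forall k, 0 <= E k) -> (forall k, 0 <= z k) -> 1 <= C -> 0 <= c ->
  (forall k, z k.+1 <= C * z k) ->
  (forall k, V k <= c * \sum_(r < q) E (k + r)%N + eta k) ->
  eta k @[k --> \oo] --> (0 : R) -> V k @[k --> \oo] --> Vinf -> (forall k, 0 <= V k) ->
  (exists B, forall k, \sum_(t < k) z t * E t <= B) ->
  ~ (exists B, forall k, \sum_(t < k) z t <= B) -> Vinf = 0.
Proof.
move=> E0 z0 C1 c0 zC VE eta0 cV V0 [B zEB] zoo.
have Vinf0 : 0 <= Vinf by rewrite -(cvg_lim _ cV)//; apply: limr_ge => //;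
  [exact: cvgP cV|exact: nearW].
apply/eqP/negPn/negP => Vn0; apply: zoo.
have Vinf_gt0 : 0 < Vinf by rewrite lt_neqAle eq_sym Vn0.
(* From some time on [V] exceeds three quarters of its limit and [eta] is below one quarter, which
   leaves [Vinf / 2] for the energy. *)
have V4 : 0 < Vinf / 4 by rewrite divr_gt0.
have /cvgrPdist_lt/(_ _ V4)[K1 _ h1] := cV.
have /cvgrPdist_lt/(_ _ V4)[K2 _ h2] := eta0.
pose K := maxn K1 K2.
have low k : (K <= k)%N -> Vinf / 2 <= c * \sum_(r < q) E (k + r)%N.
  move=> Kk; have := h1 k (leq_trans (leq_maxl _ _) Kk); have := h2 k (leq_trans (leq_maxr _ _) Kk).
  by have := VE k; rewrite /= !ltr_norml; lra.
have zCr k r : z (k + r)%N <= C ^+ r * z k.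
  elim: r => [|r IH]; first by rewrite addn0 expr0 mul1r.
  rewrite addnS exprS -mulrA; apply: le_trans (zC _) _.
  by rewrite ler_wpM2l//; lra.
have C0 : 0 <= C by lra.
(* The weight is taken at the end of the window: the growth condition bounds a later [z] by an
   earlier one, so [z (k + q)] is at most [C ^+ q] times each [z (k + r)]. *)
have key k : (K <= k)%N -> z (k + q)%N * (Vinf / 2) <= c * C ^+ q * \sum_(r < q) z (k + r)%N * E
  (k + r)%N.
  move=> Kk; apply: le_trans (ler_wpM2l (z0 _) (low k Kk)) _.
  rewrite mulrCA -mulrA ler_wpM2l// !mulr_sumr; apply: ler_sum => r _.
  rewrite [leRHS]mulrA ler_wpM2r//.
  have -> : (k + q)%N = (k + r + (q - r))%N by rewrite -addnA subnKC// ltnW.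
  apply: le_trans (zCr _ _) _; rewrite ler_wpM2r//.
  by rewrite ler_weXn2l// leq_subr.
have B0 : 0 <= B by have := zEB 0%N; rewrite big_ord0.
have shiftB r k : \sum_(t < k) z (t + r)%N * E (t + r)%N <= B.
  apply: le_trans (zEB (r + k)%N); rewrite big_split_ord/=.
  under eq_bigr do rewrite addnC.
  by rewrite lerDr; apply: sumr_ge0 => t _; rewrite mulr_ge0.
exists (\sum_(t < K + q) z t + (Vinf / 2)^-1 * (c * C ^+ q * (q%:R * B))) => k.
apply: (@le_trans _ _ (\sum_(t < K + q + k) z t)).
  rewrite addnC big_split_ord/= lerDl; apply: sumr_ge0 => t _; exact: z0.
rewrite big_split_ord/= lerD2l mulrC ler_pdivlMr ?divr_gt0//.
rewrite mulr_suml.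
apply: (@le_trans _ _ (\sum_(t < k) c * C ^+ q * \sum_(r < q) z (t + (K + r))%N * E (t + (K +
  r))%N)).
  apply: ler_sum => t _; have := key (K + t)%N (leq_addr _ _).
  rewrite addnAC => /le_trans; apply; rewrite le_eqVlt; apply/orP; left; apply/eqP.
  by congr (_ * _); apply: eq_bigr => r _; rewrite addnCA addnA.
rewrite -mulr_sumr ler_wpM2l ?mulr_ge0 ?exprn_ge0// exchange_big/=.
apply: (@le_trans _ _ (\sum_(r < q) B)); first by apply: ler_sum => r _; exact: shiftB.
by rewrite sumr_const card_ord mulr_natl.
Qed.

End RealSequences.

(** * Graph connectivity and persistent excitation *)

Section Euclid.
Context (R : realType).
Implicit Types n m : nat.

Definition dotv n (u v : 'cV[R]_n) : R := \sum_r u r 0 * v r 0.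
Definition nsq n (u : 'cV[R]_n) : R := \sum_r u r 0 ^+ 2.

Lemma nsq_ge0 n (u : 'cV[R]_n) : 0 <= nsq u.
Proof. by apply: sumr_ge0 => r _; exact: sqr_ge0. Qed.

Lemma vnorm_sqr n (u : 'cV[R]_n) : vnorm u ^+ 2 = nsq u.
Proof. by rewrite sqr_sqrtr// nsq_ge0. Qed.

Lemma coord_sqr_le n (u : 'cV[R]_n) r : u r 0 ^+ 2 <= nsq u.
Proof. by rewrite /nsq (bigD1 r)//= lerDl; apply: sumr_ge0 => s _; exact: sqr_ge0. Qed.

Lemma opnorm_nsq n m (M : 'M[R]_(m, n)) c x : 0 <= c -> opnorm_le M c ->
  nsq (M *m x) <= c ^+ 2 * nsq x.
Proof.
move=> c0 /(_ x) h; rewrite -!vnorm_sqr -exprMn lerXn2r// nnegrE ?sqrtr_ge0//.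
by rewrite mulr_ge0// sqrtr_ge0.
Qed.

Lemma dotv_mulmx n (u v : 'cV[R]_n) : (u^T *m v) 0 0 = dotv u v.
Proof. by rewrite mxE; apply: eq_bigr => r _; rewrite mxE. Qed.

Lemma dotv_nsq n (u : 'cV[R]_n) : dotv u u = nsq u. Proof. by []. Qed.

Lemma dotvDr n (u v w : 'cV[R]_n) : dotv u (v + w) = dotv u v + dotv u w.
Proof. by rewrite -big_split/=; apply: eq_bigr => r _; rewrite mxE mulrDr. Qed.

Lemma dotvBr n (u v w : 'cV[R]_n) : dotv u (v - w) = dotv u v - dotv u w.
Proof. by rewrite -sumrB; apply: eq_bigr => r _; rewrite !mxE mulrBr. Qed.

Lemma dotvZr n (u v : 'cV[R]_n) c : dotv u (c *: v) = c * dotv u v.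
Proof. by rewrite mulr_sumr; apply: eq_bigr => r _; rewrite mxE mulrCA. Qed.

Lemma nsqD n (u v : 'cV[R]_n) : nsq (u + v) = nsq u + 2 * dotv u v + nsq v.
Proof.
rewrite /nsq /dotv mulr_sumr -!big_split/=; apply: eq_bigr => r _; rewrite mxE; ring.
Qed.

Lemma nsqB n (u v : 'cV[R]_n) : nsq (u - v) = nsq u - 2 * dotv u v + nsq v.
Proof.
rewrite /nsq /dotv mulr_sumr -sumrB -!big_split/=; apply: eq_bigr => r _; rewrite !mxE; ring.
Qed.

Lemma nsqZ n (u : 'cV[R]_n) c : nsq (c *: u) = c ^+ 2 * nsq u.
Proof. by rewrite mulr_sumr; apply: eq_bigr => r _; rewrite mxE exprMn. Qed.

Lemma nsqD_le n (u v : 'cV[R]_n) : nsq (u + v) <= 2 * nsq u + 2 * nsq v.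
Proof. by have := nsq_ge0 (u - v); rewrite nsqB nsqD; lra. Qed.

Lemma nsqB_le n (u v : 'cV[R]_n) : nsq (u - v) <= 2 * nsq u + 2 * nsq v.
Proof. by have := nsq_ge0 (u + v); rewrite nsqB nsqD; lra. Qed.

Lemma dotv_trmx n m (M : 'M[R]_(m, n)) u v : dotv u (M^T *m v) = dotv (M *m u) v.
Proof. by rewrite -!dotv_mulmx trmx_mul mulmxA. Qed.

(** With [y = M^T *m v] one has [dotv (M *m y) v = nsq y]; expanding [nsq (M *m y - c *: v) >= 0]
    then gives the bound. *)
Lemma nsq_trmx n m (M : 'M[R]_(m, n)) c v : 0 < c ->
  (forall x, nsq (M *m x) <= c * nsq x) -> nsq (M^T *m v) <= c * nsq v.
Proof.
move=> c0 h; set y := M^T *m v.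
have e : dotv (M *m y) v = nsq y by rewrite -dotv_trmx.
have := nsq_ge0 (M *m y - c *: v); rewrite nsqB dotvZr e nsqZ.
have := h y => h1 h2; rewrite -(ler_pM2l c0).
by move: h1 h2; rewrite expr2; nra.
Qed.

Lemma loewner_excitation n p N (m : 'I_N -> nat) (H : forall i : 'I_N, nat -> 'M[R]_(m i, n))
    (delta : R) (k : nat) (x : 'cV[R]_n) :
  loewner_ge ((p%:R)^-1 *: \sum_(k <= t < k + p) \sum_(i < N) (H i t)^T *m H i t) (delta%:M) ->
  delta * nsq x <= (p%:R)^-1 * \sum_(r < p) \sum_i nsq (H i (k + r)%N *m x).
Proof.
move=> /(_ x).
rewrite mulmxBr mulmxBl mxE [X in _ + X]mxE subr_ge0 mul_mx_scalar -scalemxAl mxE dotv_mulmx.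
move=> /le_trans; apply; rewrite -scalemxAr -scalemxAl mxE ler_wpM2l ?invr_ge0//.
rewrite mulmx_sumr mulmx_suml summxE -{1}[k]add0n big_addn addnC addnK big_mkord.
apply: ler_sum => t _; rewrite mulmx_sumr mulmx_suml summxE; apply: ler_sum => i _.
by rewrite mulmxA -(mulmxA _ _ x) -trmx_mul dotv_mulmx addnC.
Qed.

Lemma phi_dot n k (u : 'cV[R]_n) (r : 'I_n) : (r : nat) = (k.-1 %% n)%N ->
  dotv (phi n k) u = u r 0.
Proof.
move=> rk; rewrite /dotv (bigD1 r)//= mxE rk eqxx mul1r big1 ?addr0// => s sr.
by rewrite mxE -rk; have /negbTE -> : (s : nat) != r by []; rewrite mul0r.
Qed.

Lemma phi_nsq n k : nsq (phi n k : 'cV[R]_n) <= 1.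
Proof.
rewrite /nsq; case: n => [|n]; first by rewrite big_ord0.
have n0 := ltn0Sn n; rewrite (bigD1 (Ordinal (ltn_pmod k.-1 n0)))//= big1 => [|s].
  by rewrite mxE eqxx expr1n addr0.
by rewrite -val_eqE/= mxE => /negbTE ->; rewrite expr0n.
Qed.

Lemma phi_dot_sqr n k (u : 'cV[R]_n) : dotv (phi n k) u ^+ 2 <= nsq u.
Proof.
case: n u => [|n] u; first by rewrite /dotv big_ord0 expr0n nsq_ge0.
have n0 := ltn0Sn n; by rewrite (@phi_dot _ _ _ (Ordinal (ltn_pmod k.-1 n0))) ?coord_sqr_le.
Qed.

(** The probed coordinate runs cyclically, so [n] consecutive times meet every coordinate. *)
Lemma phi_window n q k (u : 'cV[R]_n) : (1 <= k)%N -> (n <= q)%N ->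
  nsq u <= n%:R * \sum_(r < q) dotv (phi n (k + r)) u ^+ 2.
Proof.
move=> k1 nq.
apply: (@le_trans _ _ (\sum_(c < n) \sum_(r < q) dotv (phi n (k + r)) u ^+ 2)); last first.
  by rewrite sumr_const card_ord mulr_natl.
apply: ler_sum => c _.
have n0 : (0 < n)%N by apply: leq_ltn_trans (ltn_ord c).
(* This offset is the delay until coordinate [c] is next probed, counted from time [k]. *)
have rq : ((c + (n - k.-1 %% n)) %% n < q)%N by rewrite (leq_trans (ltn_pmod _ n0)).
rewrite (bigD1 (Ordinal rq))//= (@phi_dot _ _ _ c).
  by rewrite lerDl; apply: sumr_ge0 => s _; exact: sqr_ge0.
case: k k1 {rq} => //= y _.
have e : ((y + (n - y %% n)) %% n = 0)%N.
  by rewrite -modnDml subnKC ?modnn// ltnW// ltn_pmod.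
by rewrite modnDmr addnCA -modnDmr e addn0 modn_small.
Qed.

End Euclid.

(** * Connectivity from the rank of the Laplacian *)

Section Graph.
Context (R : realType) (N : nat) (a : 'M[R]_N).
Context (a_sym : forall i j, a i j = a j i) (a_ge0 : forall i j, 0 <= a i j).
Context (rank_lap : \rank (laplacian a) = N.-1).

(** By the rank condition the kernel is a line, spanned by the constant vector. The indicator of the
    component of [i] is constant along edges, hence in the kernel, hence constant, and its value at
    [i] is 1. *)
Lemma laplacian_connected (i j : 'I_N) : connect (fun k l => 0 < a k l) i j.
Proof.
have suma k : \sum_(l | 0 < a k l) a k l = \sum_l a k l.
  rewrite big_mkcond; apply: eq_bigr => l _; case: ifPn => //.
  by rewrite -leNgt => h; apply/eqP; rewrite eq_le h a_ge0.
(* Entry [l] of the product is the sum over [k] of [a l k * (u l - u k)]. *)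
have ker (u : 'rV[R]_N) : (forall k l, 0 < a k l -> u 0 k = u 0 l) -> u *m laplacian a = 0.
  move=> uc; apply/rowP => l; rewrite !mxE.
  under eq_bigr do rewrite mxE mulrBr.
  rewrite sumrB (_ : \sum_k _ = u 0 l * \sum_k a l k); last first.
    rewrite (bigD1 l)//= eqxx mul1r suma [X in _ + X]big1 ?addr0// => k /negbTE ->.
    by rewrite mul0r mulr0.
  rewrite mulr_sumr -sumrB big1// => k _; rewrite (a_sym k l) -mulrBl.
  have [/uc ->|] := ltP 0 (a l k); first by rewrite subrr mul0r.
  by move=> h; rewrite (_ : a l k = 0) ?mulr0//; apply/eqP; rewrite eq_le h a_ge0.
pose one : 'rV[R]_N := const_mx 1.
pose comp : 'rV[R]_N := \row_k (connect (fun k l => 0 < a k l) i k)%:R.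
have N0 : (0 < N)%N by apply: leq_ltn_trans (ltn_ord i).
have k1 : (one <= kermx (laplacian a))%MS by apply/sub_kermxP/ker => k l _; rewrite !mxE.
have k2 : (comp <= kermx (laplacian a))%MS.
  apply/sub_kermxP/ker => k l kl; rewrite !mxE; congr (_%:R); congr nat_of_bool.
  apply/idP/idP => h; apply: (connect_trans h); apply: connect1 => //.
  by rewrite a_sym.
have rk : \rank (kermx (laplacian a)) = 1%N.
  by rewrite mxrank_ker rank_lap -subn1 subKn.
have one0 : one != 0.
  by apply/eqP => /rowP/(_ i)/eqP; rewrite !mxE oner_eq0.
have k3 : (kermx (laplacian a) <= one)%MS.
  by rewrite -(mxrank_leqif_sup k1) rk rank_rV one0.
have /sub_rVP[c hc] := submx_trans k2 k3.
have := congr1 (fun u : 'rV[R]_N => u 0 i) hc; rewrite !mxE connect0 mulr1 => c1.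
have := congr1 (fun u : 'rV[R]_N => u 0 j) hc; rewrite !mxE -c1 mulr1.
by case: (connect _ i j) => // /eqP; rewrite eq_sym oner_eq0.
Qed.

(** A discrete Poincaré inequality, which takes the place of the spectral gap
    $\lambda_2(\mathcal{L}) > 0$. A path from [i] to [j] bounds the difference by differences along
    edges, and summing the constants of all pairs makes the constant uniform. *)
Lemma graph_poincare : exists c : R, 0 <= c /\ forall (x : 'I_N -> R) i j,
  (x i - x j) ^+ 2 <= c * \sum_k \sum_l a k l * (x k - x l) ^+ 2.
Proof.
pose En (x : 'I_N -> R) := \sum_k \sum_l a k l * (x k - x l) ^+ 2.
have En0 x : 0 <= En x.
  by apply: sumr_ge0 => k _; apply: sumr_ge0 => l _; rewrite mulr_ge0 ?sqr_ge0.
have edge i j (x : 'I_N -> R) : 0 < a i j -> (x i - x j) ^+ 2 <= (a i j)^-1 * En x.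
  move=> aij; rewrite mulrC ler_pdivlMr// mulrC /En (bigD1 i)//= (bigD1 j)//= -addrA lerDl.
  rewrite addr_ge0//; first by apply: sumr_ge0 => l _; rewrite mulr_ge0 ?sqr_ge0.
  by apply: sumr_ge0 => k _; apply: sumr_ge0 => l _; rewrite mulr_ge0 ?sqr_ge0.
have pair i j : exists c : R, 0 <= c /\ forall x : 'I_N -> R, (x i - x j) ^+ 2 <= c * En x.
  have /connectP[s] := laplacian_connected i j.
  elim: s i => [|k s IH] i /=; first by move=> _ ->; exists 0; split => // x;
    rewrite subrr expr0n mul0r.
  move=> /andP[ik ks] ej; have [c [c0 hc]] := IH k ks ej.
  (* From [(u + v)^2 <= 2 u^2 + 2 v^2], with the first edge of the path split off. *)
  exists (2 * (a i k)^-1 + 2 * c); split.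
    by rewrite addr_ge0// mulr_ge0// invr_ge0 ltW.
  move=> x; have := edge _ _ x ik; have := hc x; have := sqr_ge0 ((x i - x k) - (x k - x j)).
  rewrite mulrDl -!mulrA; set u := _ * En x; set v := _ * En x.
  by move=> h1 h2 h3; move: h1 h2 h3; rewrite !expr2; nra.
have /choice[c hc] : forall q : 'I_N * 'I_N, exists c : R, 0 <= c /\
    forall x : 'I_N -> R, (x q.1 - x q.2) ^+ 2 <= c * En x by move=> [i j]; exact: pair.
exists (\sum_q c q); split; first by apply: sumr_ge0 => q _; case: (hc q).
move=> x i j; apply: le_trans ((hc (i, j)).2 x) _; rewrite ler_wpM2r ?En0//.
by rewrite (bigD1 (i, j))//= lerDl; apply: sumr_ge0 => q _; case: (hc q).
Qed.

End Graph.

(** * The quadratic form and its coercivity over a window *)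

Section Energy.
Context (R : realType) (N n p : nat) (m : 'I_N -> nat) (a : 'M[R]_N).
Context (a_sym : forall i j, a i j = a j i) (a_ge0 : forall i j, 0 <= a i j).
Context (rank_lap : \rank (laplacian a) = N.-1).
Context (H : forall i : 'I_N, nat -> 'M[R]_(m i, n)) (c delta : R).
Context (c_gt0 : 0 < c) (H_le : forall i k x, (1 <= k)%N -> nsq (H i k *m x) <= c * nsq x).
Context (p_gt0 : (0 < p)%N) (delta_gt0 : 0 < delta).
Context (H_pe : forall k x, (1 <= k)%N ->
  delta * nsq x <= (p%:R)^-1 * \sum_(r < p) \sum_i nsq (H i (k + r)%N *m x)).

(** This is the form [E_k] of the overview. At a single time it sees one coordinate of the
    disagreements and the directions observed by [H i t], so it can only be coercive after summation
    over a window. *)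
Definition energy (t : nat) (u : 'I_N -> 'cV[R]_n) : R :=
  \sum_i \sum_j a i j * (dotv (phi n t) (u i) - dotv (phi n t) (u j)) ^+ 2 +
  \sum_i nsq (H i t *m u i).

Lemma energy_ge0 t u : 0 <= energy t u.
Proof.
apply: addr_ge0; last by apply: sumr_ge0 => i _; exact: nsq_ge0.
by apply: sumr_ge0 => i _; apply: sumr_ge0 => j _; rewrite mulr_ge0 ?sqr_ge0.
Qed.

Lemma energyD_le t u v : energy t u <= 2 * energy t v + 2 * energy t (fun i => u i - v i).
Proof.
rewrite /energy !mulrDr addrACA; apply: lerD.
  rewrite !mulr_sumr -big_split/=; apply: ler_sum => i _.
  rewrite !mulr_sumr -big_split/=; apply: ler_sum => j _; rewrite !dotvBr.
  set x := dotv _ (u i); set y := dotv _ (u j); set x' := dotv _ (v i); set y' := dotv _ (v j).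
  have := mulr_ge0 (a_ge0 i j) (sqr_ge0 ((x - y) - 2 * (x' - y'))).
  by rewrite !expr2; lra.
rewrite !mulr_sumr -big_split/=; apply: ler_sum => i _.
have -> : H i t *m u i = H i t *m v i + H i t *m (u i - v i).
  by rewrite -mulmxDr subrKC.
exact: nsqD_le.
Qed.

Lemma energy_le : exists c', 0 <= c' /\ forall t u, (1 <= t)%N ->
  energy t u <= c' * \sum_i nsq (u i).
Proof.
exists (\sum_i \sum_j a i j * 4 + c); split.
  rewrite addr_ge0 ?(ltW c_gt0)//.
  by apply: sumr_ge0 => i _; apply: sumr_ge0 => j _; rewrite mulr_ge0.
move=> t u t1; rewrite mulrDl; apply: lerD; last first.
  by rewrite mulr_sumr; apply: ler_sum => i _; exact: H_le.
rewrite mulr_suml; apply: ler_sum => i _; rewrite mulr_suml; apply: ler_sum => j _.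
rewrite -mulrA ler_wpM2l//.
have le_all k : nsq (u k) <= \sum_i nsq (u i).
  by rewrite (bigD1 k)//= lerDl; apply: sumr_ge0 => l _; exact: nsq_ge0.
have := phi_dot_sqr t (u i); have := phi_dot_sqr t (u j).
have := le_all i; have := le_all j.
set x := dotv _ (u i); set y := dotv _ (u j).
by have := sqr_ge0 (x + y); rewrite !expr2; lra.
Qed.

(** Probing all coordinates controls the differences along edges, and the Poincaré inequality,
    applied coordinate by coordinate, controls all differences. Every [u i] in the observation terms
    can then be replaced by one fixed [u j], to which persistent excitation applies. *)
Lemma energy_coercive : exists c', 0 <= c' /\ forall k u, (1 <= k)%N ->
  \sum_i nsq (u i) <= c' * \sum_(r < n + p) energy (k + r) u.
Proof.
have [cg [cg0 hg]] := graph_poincare a_sym a_ge0 rank_lap.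
pose c1 := cg * n%:R; have c10 : 0 <= c1 by rewrite mulr_ge0.
(* The 2 is the observation energy itself; the other term is the cost of replacing [u i] by [u j],
   for [p] times and [N] sensors. *)
pose c2 := (delta^-1 * (p%:R)^-1) * (2 + p%:R * N%:R * (2 * c * c1)).
have c20 : 0 <= c2.
  rewrite mulr_ge0 ?mulr_ge0 ?invr_ge0 ?(ltW delta_gt0)// addr_ge0// mulr_ge0// ?mulr_ge0//.
  by rewrite ltW.
exists (N%:R * c2); split; first by rewrite mulr_ge0.
move=> k u k1; set S := \sum_(r < n + p) _.
have h1 : \sum_i \sum_j a i j * nsq (u i - u j) <= n%:R * S.
  apply: (@le_trans _ _ (\sum_i \sum_j n%:R * \sum_(r < n + p)
      a i j * (dotv (phi n (k + r)) (u i) - dotv (phi n (k + r)) (u j)) ^+ 2)).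
    apply: ler_sum => i _; apply: ler_sum => j _.
    rewrite -mulr_sumr mulrCA ler_wpM2l//.
    under eq_bigr do rewrite -dotvBr.
    by apply: phi_window => //; rewrite leq_addr.
  under eq_bigr do rewrite -mulr_sumr.
  rewrite -mulr_sumr ler_wpM2l//.
  under eq_bigr do rewrite exchange_big/=.
  rewrite exchange_big/= /S; apply: ler_sum => r _.
  by rewrite lerDl; apply: sumr_ge0 => i _; exact: nsq_ge0.
have h2 i j : nsq (u i - u j) <= c1 * S.
  apply: (@le_trans _ _ (cg * \sum_k \sum_l a k l * nsq (u k - u l))); last first.
    by rewrite -mulrA ler_wpM2l.
  apply: (@le_trans _ _ (\sum_(r < n) cg * \sum_k \sum_l a k l * (u k r 0 - u l r 0) ^+ 2)).
    by apply: ler_sum => r _; rewrite !mxE; exact: (hg (fun k => u k r 0)).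
  rewrite -mulr_sumr ler_wpM2l// exchange_big/=; apply: ler_sum => k' _.
  rewrite exchange_big/=; apply: ler_sum => l _; rewrite mulr_sumr.
  by apply: ler_sum => r _; rewrite !mxE.
have h3 j : nsq (u j) <= c2 * S.
  have pe := H_pe (u j) k1.
  have : \sum_(r < p) \sum_i nsq (H i (k + r)%N *m u j) <= (2 + p%:R * N%:R * (2 * c * c1)) * S.
    apply: (@le_trans _ _ (\sum_(r < p) (2 * energy (k + r) u + N%:R * (2 * c * c1) * S))).
      apply: ler_sum => r _.
      apply: (@le_trans _ _ (\sum_i (2 * nsq (H i (k + r)%N *m u i) + 2 * c * c1 * S))).
        apply: ler_sum => i _.
        have -> : H i (k + r)%N *m u j = H i (k + r)%N *m u i - H i (k + r)%N *m (u i - u j).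
          by rewrite -mulmxBr subKr.
        apply: le_trans (nsqB_le _ _) _; rewrite lerD2l -2!mulrA ler_wpM2l//.
        apply: le_trans (H_le _ _ _) _; first by rewrite (leq_trans k1) ?leq_addr.
        by rewrite ler_wpM2l ?(ltW c_gt0).
      rewrite big_split/= sumr_const card_ord -[X in _ + X <= _]mulr_natl.
      apply: lerD; last by rewrite !mulrA.
      rewrite -mulr_sumr ler_wpM2l//.
      rewrite /energy lerDr; apply: sumr_ge0 => i _; apply: sumr_ge0 => l _.
      by rewrite mulr_ge0 ?sqr_ge0.
    rewrite big_split/= sumr_const card_ord -[X in _ + X <= _]mulr_natl [leRHS]mulrDl.
    apply: lerD; last by rewrite !mulrA.
    rewrite -mulr_sumr ler_wpM2l// /S.
    rewrite (big_ord_widen_cond (n + p) xpredT (fun r => energy (k + r) u)) ?leq_addl//.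
    rewrite [leRHS](bigID (fun r : 'I_(n + p) => (r < p)%N))/= lerDl.
    by apply: sumr_ge0 => r _; exact: energy_ge0.
  have pp : 0 < p%:R :> R by rewrite ltr0n.
  move=> h; rewrite -(ler_pM2l delta_gt0); apply: le_trans pe _.
  have -> : delta * (c2 * S) = (p%:R)^-1 * ((2 + p%:R * N%:R * (2 * c * c1)) * S).
    by rewrite /c2; field; rewrite !gt_eqF.
  by rewrite ler_wpM2l// invr_ge0 ltW.
apply: (@le_trans _ _ (\sum_(i < N) c2 * S)); first by apply: ler_sum => i _; exact: h3.
by rewrite sumr_const card_ord -[X in X <= _]mulr_natl mulrA.
Qed.

End Energy.

(** * One-step estimates *)

Section Step.
Context (R : realType).

Lemma dotvC n (u v : 'cV[R]_n) : dotv u v = dotv v u.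
Proof. by apply: eq_bigr => r _; rewrite mulrC. Qed.

Lemma increment_nsq n m (M : 'M[R]_(m, n)) (u f : 'cV[R]_n) (w : 'cV[R]_m) (S be c : R) :
  0 < c -> (forall x, nsq (M *m x) <= c * nsq x) -> nsq f <= 1 ->
  nsq (S *: f + be *: (M^T *m (w - M *m u))) <=
    2 * S ^+ 2 + 4 * c * (be ^+ 2 * nsq w) + 4 * c ^+ 2 * (be ^+ 2 * nsq u).
Proof.
move=> c0 hM f1; apply: le_trans (nsqD_le _ _) _; rewrite !nsqZ -!addrA; apply: lerD.
  by rewrite ler_wpM2l// ler_piMr ?sqr_ge0.
have h1 := nsq_trmx (w - M *m u) c0 hM; have h2 := nsqB_le w (M *m u); have h3 := hM u.
have h4 : nsq (M^T *m (w - M *m u)) <= 2 * c * nsq w + 2 * c ^+ 2 * nsq u.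
  apply: le_trans h1 _; have := ler_wpM2l (ltW c0) h2; have := ler_wpM2l (ltW c0) h3.
  by rewrite expr2 mulrDr -!mulrA; lra.
have := ler_wpM2l (sqr_ge0 be) h4; set b2 := be ^+ 2; set c2 := c ^+ 2.
lra.
Qed.

Lemma step_nsq n m (M : 'M[R]_(m, n)) (u f : 'cV[R]_n) (w : 'cV[R]_m) (S be c : R) :
  0 < c -> (forall x, nsq (M *m x) <= c * nsq x) -> nsq f <= 1 ->
  nsq (u + (S *: f + be *: (M^T *m (w - M *m u)))) <=
    nsq u + 2 * (S * dotv f u + be * dotv (M *m u) w - be * nsq (M *m u)) +
    (2 * S ^+ 2 + 4 * c * (be ^+ 2 * nsq w) + 4 * c ^+ 2 * (be ^+ 2 * nsq u)).
Proof.
move=> c0 hM f1; rewrite nsqD; apply: lerD; last exact: increment_nsq.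
rewrite lerD2l ler_wpM2l// dotvDr !dotvZr dotv_trmx dotvBr dotv_nsq (dotvC u f).
by rewrite mulrBr addrA.
Qed.

Lemma sum_sqr_le N (y : 'I_N -> R) : (\sum_i y i) ^+ 2 <= N%:R * \sum_i y i ^+ 2.
Proof.
rewrite expr2 mulr_suml.
apply: (@le_trans _ _ (\sum_i \sum_j 2^-1 * (y i ^+ 2 + y j ^+ 2))).
  apply: ler_sum => i _; rewrite mulr_sumr; apply: ler_sum => j _.
  by have := sqr_ge0 (y i - y j); rewrite !expr2; lra.
under eq_bigr do rewrite -mulr_sumr big_split/= sumr_const card_ord.
rewrite -mulr_sumr big_split/= sumr_const card_ord sumrMnl mulr_natl.
set s := _ *+ N; lra.
Qed.

End Step.

(** * Pathwise analysis of the algorithm *)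

Section Algorithm.
Context (R : realType) (T : Type) (N n : nat) (m : 'I_N -> nat) (a : 'M[R]_N).
Context (nu b : 'I_N -> 'I_N -> R) (alpha : 'I_N -> 'I_N -> nat -> R) (beta : 'I_N -> nat -> R).
Context (H : forall i : 'I_N, nat -> 'M[R]_(m i, n)) (theta : 'cV[R]_n).
Context (theta0 : 'I_N -> 'cV[R]_n).
Context (w : forall i : 'I_N, nat -> T -> 'cV[R]_(m i)) (d : 'I_N -> nat -> T -> R).

(* The quantities below with index [k] belong to the step from time [k] to [k.+1]. *)
Definition est (k : nat) (om : T) : 'I_N -> 'cV[R]_n :=
  sc_est a nu b alpha beta H theta theta0 w d k om.
Definition err k om i : 'cV[R]_n := est k om i - theta.
Definition lyap k om : R := \sum_i nsq (err k om i).
Definition probe k om i : R := dotv (phi n k.+1) (est k om i).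
Definition threshold k i j : R := nu i j * b i j * ln (k.+1%:R).
(** This is $G_{ij,k+1}$; it is also the conditional mean of the message from [i] to [j] when [i]
    probes the value [z]. *)
Definition mean_bit k i j (z : R) : R :=
  lap_cdf ((z - threshold k i j) / b i j) - lap_cdf ((- z - threshold k i j) / b i j).
Definition received k om j i : R :=
  quantized (threshold k j i) (probe k om j + b j i * d j k.+1 om).
Definition bit_noise k om j i : R := received k om j i - mean_bit k j i (probe k om j).
Definition gain k i j : R := alpha i j k.+1 * a i j.
(** The sum may run over all sensors because [gain] vanishes off the edges; this makes it possible
    to exchange [i] and [j] freely. *)
Definition innovation k om i : R :=
  \sum_j gain k i j * (received k om j i - mean_bit k i j (probe k om i)).

Context (a_sym : forall i j, a i j = a j i) (a_ge0 : forall i j, 0 <= a i j).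
Context (nu_sym : forall i j, 0 < a i j -> nu i j = nu j i).
Context (nu_ge0 : forall i j, 0 < a i j -> 0 <= nu i j).
Context (b_sym : forall i j, 0 < a i j -> b i j = b j i).
Context (b_gt0 : forall i j, 0 < a i j -> 0 < b i j).
Context (alpha_sym : forall i j k, 0 < a i j -> (1 <= k)%N -> alpha i j k = alpha j i k).
Context (alpha_gt0 : forall i j k, 0 < a i j -> (1 <= k)%N -> 0 < alpha i j k).
Context (beta_gt0 : forall i k, (1 <= k)%N -> 0 < beta i k).

Let no_edge i j : ~~ (0 < a i j) -> a i j = 0.
Proof. by rewrite -leNgt => h; apply/eqP; rewrite eq_le h a_ge0. Qed.

Lemma est_step k om i : est k.+1 om i = est k om i + innovation k om i *: phi n k.+1 +
  beta i k.+1 *: ((H i k.+1)^T *m (H i k.+1 *m theta + w i k.+1 om - H i k.+1 *m est k om i)).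
Proof.
rewrite -[LHS]/(sc_step a nu b alpha beta H theta (fun i => w i k.+1 om)
  (fun i => d i k.+1 om) k.+1 (est k om) i).
rewrite /sc_step; cbv beta zeta.
rewrite (_ : \sum_(j | 0 < a i j) _ = innovation k om i)//.
rewrite /innovation [LHS]big_mkcond; apply: eq_bigr => j _.
rewrite /gain; case: ifPn => [_|/no_edge ->]; last by rewrite mulr0 mul0r.
by rewrite /received /mean_bit /threshold /quantized /probe !dotv_mulmx.
Qed.

Lemma err_step k om i : err k.+1 om i = err k om i + (innovation k om i *: phi n k.+1 +
  beta i k.+1 *: ((H i k.+1)^T *m (w i k.+1 om - H i k.+1 *m err k om i))).
Proof.
rewrite /err est_step.
have -> : H i k.+1 *m theta + w i k.+1 om - H i k.+1 *m est k om i =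
    w i k.+1 om - H i k.+1 *m (est k om i - theta).
  by rewrite mulmxBr opprB addrA [w i k.+1 om + _]addrC.
by rewrite -!addrA; congr (_ + _); rewrite [- theta + _]addrC -addrA.
Qed.

Lemma probe_sub k om i j : probe k om i - probe k om j =
  dotv (phi n k.+1) (err k om i) - dotv (phi n k.+1) (err k om j).
Proof. by rewrite /err !dotvBr /probe; ring. Qed.

Lemma gain_sym k i j : gain k i j = gain k j i.
Proof.
rewrite /gain; have [e|/no_edge e] := boolP (0 < a i j).
  by rewrite (alpha_sym e)// a_sym.
by rewrite (a_sym j i) e !mulr0.
Qed.

Lemma gain_ge0 k i j : 0 <= gain k i j.
Proof.
rewrite /gain; have [e|/no_edge ->] := boolP (0 < a i j); last by rewrite mulr0.
by rewrite mulr_ge0 ?ltW ?alpha_gt0.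
Qed.

(** The coefficients are symmetric on edges only; the factor [gain] makes the identity hold for all
    pairs. *)
Lemma gain_mean_bit_sym k i j z : gain k i j * mean_bit k i j z = gain k i j * mean_bit k j i z.
Proof.
rewrite /gain; have [e|/no_edge ->] := boolP (0 < a i j); last by rewrite mulr0 !mul0r.
by rewrite /mean_bit /threshold (nu_sym e) (b_sym e).
Qed.

(** The first distribution function is evaluated inside [[-(K + C) / b, (K + C) / b]], where its
    slope is at least a constant times [expR (- (K + C) / b)]. Since [C / b = nu * ln k.+1], this
    exponential is [expR (- (K / b))] divided by [k.+1 ^ nu]. The second one decreases in [z] and is
    subtracted, so it can only add to the increment. *)
Lemma mean_bit_slope k i j K x y : 0 < a i j -> - K <= x -> x <= y -> y <= K ->
  2^-1 * expR (- (K / b i j)) / b i j / ((k.+1%:R) `^ nu i j) * (y - x) <=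
    mean_bit k i j y - mean_bit k i j x.
Proof.
move=> e Kx xy yK; have b0 := b_gt0 e; rewrite /mean_bit.
set C := threshold k i j.
have C0 : 0 <= C.
  by apply: mulr_ge0; [apply: mulr_ge0; [exact: nu_ge0|exact: ltW]|rewrite ln_ge0// ler1n].
have bi : 0 < (b i j)^-1 by rewrite invr_gt0.
have := @lap_cdf_slope _ ((K + C) / b i j) ((x - C) / b i j) ((y - C) / b i j).
rewrite -mulNr !ler_pM2r// => /(_ ltac:(lra) ltac:(lra) ltac:(lra)).
have := @lap_cdf_lip _ ((- y - C) / b i j) ((- x - C) / b i j).
rewrite ler_pM2r// => /(_ ltac:(lra)) /andP[h1 _].
have -> : expR (- (K + C) / b i j) = expR (- (K / b i j)) / (k.+1%:R `^ nu i j).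
  rewrite /powR pnatr_eq0/= -expRN -expRD; congr expR; rewrite /C /threshold.
  by field; rewrite gt_eqF.
have -> : (y - C) / b i j - (x - C) / b i j = (y - x) / b i j by field; rewrite gt_eqF.
rewrite [X in X <= _ -> _](_ : _ = 2^-1 * expR (- (K / b i j)) / b i j / ((k.+1%:R) `^ nu i j) *
  (y - x)); last by ring.
lra.
Qed.

Lemma mean_bit_nd k i j x y : 0 < a i j -> x <= y -> mean_bit k i j x <= mean_bit k i j y.
Proof.
move=> e xy; have bi : 0 < (b i j)^-1 by rewrite invr_gt0 b_gt0.
have := @lap_cdf_lip _ ((x - threshold k i j) / b i j) ((y - threshold k i j) / b i j).
have := @lap_cdf_lip _ ((- y - threshold k i j) / b i j) ((- x - threshold k i j) / b i j).
rewrite !ler_pM2r// => /(_ ltac:(lra)) /andP[h1 _] /(_ ltac:(lra)) /andP[h2 _].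
by rewrite /mean_bit; lra.
Qed.

Lemma mean_bit_mono k i j x y : 0 < a i j ->
  0 <= (x - y) * (mean_bit k i j x - mean_bit k i j y).
Proof.
move=> e; have [xy|/ltW yx] := leP x y.
  by rewrite mulr_le0 ?subr_le0 ?mean_bit_nd.
by rewrite mulr_ge0 ?subr_ge0 ?mean_bit_nd.
Qed.

Lemma mean_bit_bound k i j z : `|mean_bit k i j z| <= 1.
Proof.
rewrite /mean_bit; set u := lap_cdf _; set v := lap_cdf _.
have := lap_cdf_ge0 ((z - threshold k i j) / b i j).
have := lap_cdf_le1 ((z - threshold k i j) / b i j).
have := lap_cdf_ge0 ((- z - threshold k i j) / b i j).
have := lap_cdf_le1 ((- z - threshold k i j) / b i j).
by rewrite -/u -/v ler_norml; lra.
Qed.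

Lemma received_bound k om j i : `|received k om j i| <= 1.
Proof.
by rewrite /received /quantized; case: ifP; [case: ifP|]; rewrite ?normrN ?normr1 ?normr0.
Qed.

Lemma innovation_sqr k om i : innovation k om i ^+ 2 <= 4 * N%:R * \sum_j gain k i j ^+ 2.
Proof.
apply: le_trans (sum_sqr_le _) _; rewrite -mulrA mulrCA ler_wpM2l//.
rewrite mulr_sumr; apply: ler_sum => j _; rewrite exprMn mulrC ler_wpM2r ?sqr_ge0//.
have := received_bound k om j i; have := mean_bit_bound k i j (probe k om i).
rewrite !ler_norml; set u := received _ _ _ _; set v := mean_bit _ _ _ _.
by move=> /andP[? ?] /andP[? ?]; rewrite expr2; nra.
Qed.

(* Symmetrization over the edges, as for a Dirichlet form. *)
Lemma consensus_dissipation k om :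
  \sum_i dotv (phi n k.+1) (err k om i) * \sum_j gain k i j *
     (mean_bit k i j (probe k om j) - mean_bit k i j (probe k om i)) =
  - (2^-1 * \sum_i \sum_j gain k i j * ((probe k om i - probe k om j) *
     (mean_bit k i j (probe k om i) - mean_bit k i j (probe k om j)))).
Proof.
set f := fun i => dotv (phi n k.+1) (err k om i).
pose F i j := f i * (gain k i j *
  (mean_bit k i j (probe k om j) - mean_bit k i j (probe k om i))).
transitivity (\sum_i \sum_j F i j).
  by apply: eq_bigr => i _; rewrite mulr_sumr.
have E : \sum_i \sum_j F i j = \sum_i \sum_j F j i by rewrite exchange_big.
have -> : \sum_i \sum_j F i j = 2^-1 * (\sum_i \sum_j (F i j + F j i)).
  have -> : \sum_i \sum_j (F i j + F j i) = \sum_i \sum_j F i j + \sum_i \sum_j F j i.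
    by rewrite -big_split/=; apply: eq_bigr => i _; rewrite big_split.
  by rewrite -E; lra.
rewrite -mulrN -sumrN; congr (_ * _); apply: eq_bigr => i _.
rewrite -sumrN; apply: eq_bigr => j _.
rewrite /F (gain_sym k j i) probe_sub -/(f i) -/(f j).
rewrite [gain k i j * (mean_bit k j i _ - _)]mulrBr -!gain_mean_bit_sym.
set x := mean_bit _ _ _ _; set y := mean_bit _ _ _ _; ring.
Qed.

(** The message from [j] is centred at its own conditional mean; what remains is a drift that
    compares the same function [mean_bit k i j] at the two probed values. *)
Lemma innovation_split k om i : innovation k om i =
  \sum_j gain k i j * bit_noise k om j i +
  \sum_j gain k i j * (mean_bit k i j (probe k om j) - mean_bit k i j (probe k om i)).
Proof.
rewrite -big_split; apply: eq_bigr => j _ /=; rewrite /bit_noise.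
rewrite [gain k i j * (_ - mean_bit k j i _)]mulrBr -gain_mean_bit_sym; ring.
Qed.

Context (c : R) (c_gt0 : 0 < c).
Context (H_le : forall i k x, (1 <= k)%N -> nsq (H i k *m x) <= c * nsq x).

(** The factor [2^-1] appears because the ordered pairs list each edge twice. *)
Definition dissipation k om : R :=
  2^-1 * (\sum_i \sum_j gain k i j * ((probe k om i - probe k om j) *
     (mean_bit k i j (probe k om i) - mean_bit k i j (probe k om j)))) +
  \sum_i beta i k.+1 * nsq (H i k.+1 *m err k om i).
Definition noise_term k om : R :=
  \sum_i \sum_j gain k i j * bit_noise k om j i * dotv (phi n k.+1) (err k om i) +
  \sum_i beta i k.+1 * dotv (H i k.+1 *m err k om i) (w i k.+1 om).
(** This is [r] of the overview. It depends on the outcome only through [w]: a message deviates from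
    a mean by at most 2, whence [8 * N] after Cauchy-Schwarz, and the quadratic dependence on the
    errors is left to the factor [1 + lyap]. *)
Definition perturbation k om : R :=
  8 * N%:R * \sum_i \sum_j gain k i j ^+ 2 +
  4 * c * \sum_i beta i k.+1 ^+ 2 * nsq (w i k.+1 om) + 4 * c ^+ 2 * \sum_i beta i k.+1 ^+ 2.

Lemma lyap_ge0 k om : 0 <= lyap k om.
Proof. by apply: sumr_ge0 => i _; exact: nsq_ge0. Qed.

Lemma err_nsq_le k om i : nsq (err k om i) <= lyap k om.
Proof. by rewrite /lyap (bigD1 i)//= lerDl; apply: sumr_ge0 => j _; exact: nsq_ge0. Qed.

Lemma perturbation_ge0 k om : 0 <= perturbation k om.
Proof.
have c0 := ltW c_gt0; rewrite /perturbation !addr_ge0 ?mulr_ge0 ?sqr_ge0//.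
- by apply: sumr_ge0 => i _; apply: sumr_ge0 => j _; exact: sqr_ge0.
- by apply: sumr_ge0 => i _; rewrite mulr_ge0 ?sqr_ge0 ?nsq_ge0.
- by apply: sumr_ge0 => i _; exact: sqr_ge0.
Qed.

Lemma perturbation_le k om :
  \sum_i (2 * innovation k om i ^+ 2 + 4 * c * (beta i k.+1 ^+ 2 * nsq (w i k.+1 om)) +
     4 * c ^+ 2 * (beta i k.+1 ^+ 2 * nsq (err k om i))) <=
  perturbation k om * (1 + lyap k om).
Proof.
rewrite !big_split/= -!mulr_sumr.
set g := \sum_i innovation k om i ^+ 2; set q := \sum_i _ * nsq (w _ _ _).
set e := \sum_i _ * nsq (err _ _ _); set be := \sum_i beta i k.+1 ^+ 2.
set L := lyap k om; have L0 : 0 <= L := lyap_ge0 k om.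
have hg : 2 * g <= 8 * N%:R * \sum_i \sum_j gain k i j ^+ 2.
  rewrite (_ : 8 * N%:R = 2 * (4 * N%:R)); last by ring.
  rewrite -[leRHS]mulrA ler_wpM2l// mulr_sumr; apply: ler_sum => i _; exact: innovation_sqr.
have he : e <= be * L.
  by rewrite mulr_suml; apply: ler_sum => i _; rewrite ler_wpM2l ?sqr_ge0 ?err_nsq_le.
have q0 : 0 <= q by apply: sumr_ge0 => i _; rewrite mulr_ge0 ?sqr_ge0 ?nsq_ge0.
have be0 : 0 <= be by apply: sumr_ge0 => i _; exact: sqr_ge0.
have g0 : 0 <= \sum_i \sum_j gain k i j ^+ 2.
  by apply: sumr_ge0 => i _; apply: sumr_ge0 => j _; exact: sqr_ge0.
rewrite /perturbation -/q -/be mulrDr mulr1 -!addrA.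
set G := 8 * N%:R * _ in hg *; have G0 : 0 <= G by rewrite mulr_ge0 ?mulr_ge0.
have c40 : 0 <= 4 * c ^+ 2 by rewrite mulr_ge0 ?sqr_ge0.
have := ler_wpM2l c40 he; have := mulr_ge0 G0 L0.
have := mulr_ge0 (mulr_ge0 (mulr_ge0 (ler0n R 4) (ltW c_gt0)) q0) L0.
have := mulr_ge0 c40 be0.
set C2 := 4 * c ^+ 2; rewrite !mulrDl !mulrA; lra.
Qed.

Lemma lyap_step k om : lyap k.+1 om <=
  lyap k om - 2 * dissipation k om + 2 * noise_term k om + perturbation k om * (1 + lyap k om).
Proof.
apply: (@le_trans _ _ (\sum_i (nsq (err k om i) + 2 * (innovation k om i * dotv (phi n k.+1) (err
  k om i) +
    beta i k.+1 * dotv (H i k.+1 *m err k om i) (w i k.+1 om) -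
    beta i k.+1 * nsq (H i k.+1 *m err k om i)) +
    (2 * innovation k om i ^+ 2 + 4 * c * (beta i k.+1 ^+ 2 * nsq (w i k.+1 om)) +
     4 * c ^+ 2 * (beta i k.+1 ^+ 2 * nsq (err k om i)))))).
  apply: ler_sum => i _; rewrite err_step; apply: step_nsq => //; last exact: phi_nsq.
  by move=> x; exact: H_le.
rewrite big_split/=; apply: lerD; last exact: perturbation_le.
rewrite big_split/= -/(lyap k om) -mulr_sumr sumrB big_split/=.
have -> : \sum_i innovation k om i * dotv (phi n k.+1) (err k om i) =
    \sum_i \sum_j gain k i j * bit_noise k om j i * dotv (phi n k.+1) (err k om i) -
    (2^-1 * \sum_i \sum_j gain k i j * ((probe k om i - probe k om j) *
     (mean_bit k i j (probe k om i) - mean_bit k i j (probe k om j)))).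
  rewrite -consensus_dissipation -big_split; apply: eq_bigr => i _ /=.
  by rewrite innovation_split mulrDl [X in _ + X]mulrC -mulr_suml.
by rewrite /dissipation /noise_term; lra.
Qed.

Lemma increment_le k om : \sum_i nsq (err k.+1 om i - err k om i) <=
  perturbation k om * (1 + lyap k om).
Proof.
apply: le_trans (perturbation_le k om); apply: ler_sum => i _.
rewrite err_step [_ + _ - _]addrAC subrr add0r; apply: increment_nsq => //; last exact: phi_nsq.
by move=> x; exact: H_le.
Qed.

Lemma mean_bit_slope_sqr k i j K x y : 0 < a i j -> `|x| <= K -> `|y| <= K ->
  2^-1 * expR (- (K / b i j)) / b i j / ((k.+1%:R) `^ nu i j) * (x - y) ^+ 2 <=
    (x - y) * (mean_bit k i j x - mean_bit k i j y).
Proof.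
move=> e; rewrite !ler_norml => /andP[Kx xK] /andP[Ky yK].
have [xy|/ltW yx] := leP x y.
  have := mean_bit_slope k e Kx xy yK; set s := _ / _ `^ _.
  have yx0 : 0 <= y - x by rewrite subr_ge0.
  by move=> /(ler_wpM2l yx0); rewrite expr2; lra.
have := mean_bit_slope k e Ky yx xK; set s := _ / _ `^ _.
have yx0 : 0 <= x - y by rewrite subr_ge0.
by move=> /(ler_wpM2l yx0); rewrite expr2; lra.
Qed.

Let edge_term k om i j := gain k i j * ((probe k om i - probe k om j) *
     (mean_bit k i j (probe k om i) - mean_bit k i j (probe k om j))).

Let edge_term_ge0 k om i j : 0 <= edge_term k om i j.
Proof.
rewrite /edge_term; have [e|/no_edge e] := boolP (0 < a i j); last by rewrite /gain e mulr0 mul0r.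
by rewrite mulr_ge0 ?gain_ge0 ?mean_bit_mono.
Qed.

Let obs_term_ge0 k om i : 0 <= beta i k.+1 * nsq (H i k.+1 *m err k om i).
Proof. by rewrite mulr_ge0 ?nsq_ge0// ltW ?beta_gt0. Qed.

Let edge_term_le k om i j : edge_term k om i j <= 2 * dissipation k om.
Proof.
rewrite /dissipation mulrDr mulrA mulfV// mul1r.
apply: (@le_trans _ _ (\sum_i \sum_j edge_term k om i j)).
  rewrite (bigD1 i)//= (bigD1 j)//= -addrA lerDl addr_ge0//.
    by apply: sumr_ge0 => l _; exact: edge_term_ge0.
  by apply: sumr_ge0 => k' _; apply: sumr_ge0 => l _; exact: edge_term_ge0.
by rewrite lerDl mulr_ge0//; apply: sumr_ge0 => l _; exact: obs_term_ge0.
Qed.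

Let obs_term_le k om i : beta i k.+1 * nsq (H i k.+1 *m err k om i) <= dissipation k om.
Proof.
rewrite /dissipation [X in _ + X](bigD1 i)//= addrCA lerDl addr_ge0//.
  rewrite mulr_ge0//; apply: sumr_ge0 => k' _; apply: sumr_ge0 => l _; exact: edge_term_ge0.
by apply: sumr_ge0 => l _; exact: obs_term_ge0.
Qed.

Lemma dissipation_ge0 k om : 0 <= dissipation k om.
Proof.
rewrite /dissipation addr_ge0//; last by apply: sumr_ge0 => l _; exact: obs_term_ge0.
by rewrite mulr_ge0//; apply: sumr_ge0 => k' _; apply: sumr_ge0 => l _; exact: edge_term_ge0.
Qed.

Context (rank_lap : \rank (laplacian a) = N.-1).
Context (p : nat) (delta : R) (p_gt0 : (0 < p)%N) (delta_gt0 : 0 < delta).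
Context (H_pe : forall k x, (1 <= k)%N ->
  delta * nsq x <= (p%:R)^-1 * \sum_(r < p) \sum_i nsq (H i (k + r)%N *m x)).
Context (gain_sum : forall i j, exists B, forall k, \sum_(t < k) gain t i j ^+ 2 <= B).
Context (beta_sum : forall i, exists B, forall k, \sum_(t < k) beta i t.+1 ^+ 2 <= B).
Context (z : nat -> R) (Cz : R) (z_ge0 : forall k, 0 <= z k) (Cz_ge1 : 1 <= Cz).
Context (zS : forall k, z k.+1 <= Cz * z k).
Context (z_alpha : forall i j k, 0 < a i j -> z k <= alpha i j k.+1 / (k.+1%:R `^ nu i j)).
Context (z_beta : forall i k, z k <= beta i k.+1).
Context (z_sum : ~ exists B, forall k, \sum_(t < k) z t <= B).

(** * Convergence on a fixed outcome *)

Section Path.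
Context (om : T).
Context (bit_cvg : forall i j, cvgn (fun k => \sum_(t < k) gain t i j * bit_noise t om j i *
  (dotv (phi n t.+1) (err t om i) / (1 + lyap t om)))).
Context (obs_cvg : forall i (r : 'I_(m i)), cvgn (fun k => \sum_(t < k) beta i t.+1 *
  w i t.+1 om r 0 * ((H i t.+1 *m err t om i) r 0 / (1 + lyap t om)))).
Context (obs_sum : forall i, exists B, forall k,
  \sum_(t < k) beta i t.+1 ^+ 2 * nsq (w i t.+1 om) <= B).

Let noise_cvg : cvgn (fun k => \sum_(t < k) noise_term t om / (1 + lyap t om)).
Proof.
rewrite (_ : (fun k => _) = (fun k => (\sum_i \sum_j \sum_(t < k) gain t i j * bit_noise t om j i *
  (dotv (phi n t.+1) (err t om i) / (1 + lyap t om))) +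
  (\sum_i \sum_r \sum_(t < k) beta i t.+1 *
  w i t.+1 om r 0 * ((H i t.+1 *m err t om i) r 0 / (1 + lyap t om))))).
  apply: is_cvgD.
    by apply: cvgn_big_sum => i; apply: cvgn_big_sum => j; exact: bit_cvg.
  by apply: cvgn_big_sum => i; apply: cvgn_big_sum => r; exact: obs_cvg.
apply/funext => k.
rewrite [X in _ = X + _](_ : _ = \sum_(t < k) \sum_i \sum_j gain t i j * bit_noise t om j i *
  (dotv (phi n t.+1) (err t om i) / (1 + lyap t om))); last first.
  by rewrite [RHS]exchange_big/=; apply: eq_bigr => i _; rewrite exchange_big.
rewrite [X in _ = _ + X](_ : _ = \sum_(t < k) \sum_i \sum_r beta i t.+1 *
  w i t.+1 om r 0 * ((H i t.+1 *m err t om i) r 0 / (1 + lyap t om))); last first.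
  by rewrite [RHS]exchange_big/=; apply: eq_bigr => i _; rewrite exchange_big.
rewrite -big_split/=; apply: eq_bigr => t _; rewrite /noise_term mulrDl; congr (_ + _).
  rewrite mulr_suml; apply: eq_bigr => i _; rewrite mulr_suml; apply: eq_bigr => j _.
  by rewrite mulrA.
rewrite mulr_suml; apply: eq_bigr => i _; rewrite -mulrA mulr_suml mulr_sumr.
by apply: eq_bigr => r _; ring.
Qed.

Let pert_sum : exists B, forall k, \sum_(t < k) perturbation t om <= B.
Proof.
have c0 := ltW c_gt0.
pose g1 t := \sum_i \sum_j gain t i j ^+ 2.
pose g2 t := \sum_i beta i t.+1 ^+ 2 * nsq (w i t.+1 om).
pose g3 t := \sum_i beta i t.+1 ^+ 2.
have s1 : exists B, forall k, \sum_(t < k) g1 t <= B.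
  apply: (@bounded_finite_sums R _ (fun i t => \sum_j gain t i j ^+ 2)) => i.
  exact: (@bounded_finite_sums R _ (fun j t => gain t i j ^+ 2) (gain_sum i)).
have s2 : exists B, forall k, \sum_(t < k) g2 t <= B.
  exact: (@bounded_finite_sums R _ (fun i t => beta i t.+1 ^+ 2 * nsq (w i t.+1 om)) obs_sum).
have s3 : exists B, forall k, \sum_(t < k) g3 t <= B.
  exact: (@bounded_finite_sums R _ (fun i t => beta i t.+1 ^+ 2) beta_sum).
have k1 : 0 <= 8 * N%:R :> R by rewrite mulr_ge0.
have k2 : 0 <= 4 * c by rewrite mulr_ge0.
have k3 : 0 <= 4 * c ^+ 2 by rewrite mulr_ge0 ?sqr_ge0.
exact: (@bounded_partial_sumsD R (fun t => 8 * N%:R * g1 t + 4 * c * g2 t)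
  (fun t => 4 * c ^+ 2 * g3 t) (@bounded_partial_sumsD R (fun t => 8 * N%:R * g1 t) (fun t => 4 *
    c * g2 t)
  (bounded_partial_sumsZ k1 s1) (bounded_partial_sumsZ k2 s2)) (bounded_partial_sumsZ k3 s3)).
Qed.

Lemma lyap_cvg_dissipation_sum : cvgn (lyap^~ om) /\
  exists B, forall k, \sum_(t < k) dissipation t om <= B.
Proof.
apply: (@almost_supermartingale_cvg R (lyap^~ om) (dissipation^~ om)
  (noise_term^~ om) (perturbation^~ om)) => //.
- by move=> k; exact: lyap_ge0.
- by move=> k; exact: dissipation_ge0.
- by move=> k; exact: perturbation_ge0.
- by move=> k; exact: lyap_step.
Qed.

Lemma lyap_cvg0 : lyap k om @[k --> \oo] --> (0 : R).
Proof.
have [cV Dsum] := lyap_cvg_dissipation_sum.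
have [VB hVB] := cvgn_abs_bounded cV.
have lyapB k : lyap k om <= VB by exact: le_trans (ler_norm _) (hVB k).
(* A probed value is a coordinate of the error plus one of [theta]; each is bounded through
   [|y| <= 1 + y^2]. *)
pose K := 2 + VB + nsq theta.
have abs_le (y v : R) : y ^+ 2 <= v -> `|y| <= 1 + v.
  by move=> h; rewrite ler_norml; have := sqr_ge0 (y - 1); have := sqr_ge0 (y + 1);
    rewrite !expr2; move: h; rewrite expr2; nra.
have probeB k i : `|probe k om i| <= K.
  have -> : probe k om i = dotv (phi n k.+1) (err k om i) + dotv (phi n k.+1) theta.
    by rewrite /err dotvBr subrK.
  apply: le_trans (ler_normD _ _) _.
  have h1 := abs_le _ _ (le_trans (phi_dot_sqr k.+1 (err k om i)) (le_trans (err_nsq_le k om i)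
    (lyapB k))).
  have h2 := abs_le _ _ (phi_dot_sqr k.+1 theta).
  by rewrite /K; lra.
pose E k := energy a H k.+1 (err k om).
have zE : exists B, forall k, \sum_(t < k) z t * E t <= B.
  pose g i j t := z t * (a i j * (probe t om i - probe t om j) ^+ 2).
  pose h i t := z t * nsq (H i t.+1 *m err t om i).
  have sg i j : exists B, forall k, \sum_(t < k) g i j t <= B.
    have [e|/no_edge e] := boolP (0 < a i j); last first.
      by exists 0 => k; rewrite big1// => t _; rewrite /g e mul0r mulr0.
    pose ka := 2^-1 * expR (- (K / b i j)) / b i j.
    have ka0 : 0 < ka by rewrite divr_gt0 ?mulr_gt0 ?expR_gt0 ?b_gt0.
    (* The factor [ka] comes from the slope bound on [[-K, K]], and 2 from the [2^-1] in
       [dissipation]; the power of [k.+1] in the slope is the one divided out in [z_alpha]. *)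
    apply: (@bounded_partial_sums_le R (g i j) (dissipation^~ om) (ka^-1 * 2)) => //.
      by rewrite mulr_ge0// invr_ge0 ltW.
    move=> k; rewrite -mulrA [leRHS]mulrC ler_pdivlMr//.
    apply: le_trans (edge_term_le k om i j); rewrite /g /edge_term.
    have := mean_bit_slope_sqr k e (probeB k i) (probeB k j); rewrite -/ka.
    set D2 := (probe k om i - probe k om j) ^+ 2 => sl.
    have := ler_wpM2l (gain_ge0 k i j) sl; apply: le_trans.
    have D20 : 0 <= ka * (a i j * D2).
      exact: mulr_ge0 (ltW ka0) (mulr_ge0 (a_ge0 i j) (sqr_ge0 _)).
    have := ler_wpM2r D20 (z_alpha k e); rewrite /gain => h'.
    rewrite (_ : z k * _ * ka = z k * (ka * (a i j * D2))); last by ring.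
    apply: le_trans h' _; rewrite le_eqVlt; apply/orP; left; apply/eqP; ring.
  have sh i : exists B, forall k, \sum_(t < k) h i t <= B.
    apply: (@bounded_partial_sums_le R (h i) (dissipation^~ om) 1) => //.
    move=> k; rewrite mul1r; apply: le_trans (obs_term_le k om i).
    by rewrite ler_wpM2r ?nsq_ge0.
  have s1 := @bounded_finite_sums R _ (fun i t => \sum_j g i j t)
    (fun i => @bounded_finite_sums R _ (fun j t => g i j t) (sg i)).
  have s2 := @bounded_finite_sums R _ h sh.
  have [B hB] := @bounded_partial_sumsD R (fun t => \sum_i \sum_j g i j t) (fun t => \sum_i h i
    t) s1 s2.
  exists B => k; apply: le_trans (hB k); rewrite le_eqVlt; apply/orP; left; apply/eqP.
  apply: eq_bigr => t _; rewrite /E /energy mulrDr mulr_sumr; congr (_ + _).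
    apply: eq_bigr => i _; rewrite mulr_sumr; apply: eq_bigr => j _.
    by rewrite /g probe_sub.
  by rewrite mulr_sumr.
have [c1 [c10 coer]] := energy_coercive a_sym a_ge0 rank_lap c_gt0 H_le p_gt0 delta_gt0 H_pe.
have [c2 [c20 eub]] := energy_le a_ge0 c_gt0 H_le.
pose dif r k := \sum_i nsq (err k om i - err (k + r)%N om i).
have inc0 : \sum_i nsq (err k.+1 om i - err k om i) @[k --> \oo] --> (0 : R).
  have p0 : perturbation k om * (1 + VB) @[k --> \oo] --> (0 : R).
    rewrite -[X in _ --> X](mul0r (1 + VB)); apply: cvgMr_tmp.
    by apply: bounded_partial_sums_to0 => // k; exact: perturbation_ge0.
  apply: (squeeze_cvgr _ (@cvg_cst _ 0 _ _ _) p0); apply: nearW => k; apply/andP; split.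
    by apply: sumr_ge0 => i _; exact: nsq_ge0.
  apply: le_trans (increment_le k om) _.
  by rewrite ler_wpM2l ?perturbation_ge0// lerD2l.
have dif0 r : dif r k @[k --> \oo] --> (0 : R).
  elim: r => [|r IH].
    rewrite (_ : dif 0%N = cst 0); first exact: cvg_cst.
    apply/funext => k; rewrite /dif big1// => i _; rewrite addn0 subrr /nsq big1// => s _.
    by rewrite mxE expr0n.
  pose inc k := \sum_i nsq (err k.+1 om i - err k om i).
  have incr : inc (k + r)%N @[k --> \oo] --> (0 : R).
    by have := inc0; rewrite -(cvg_shiftn r inc).
  have ub : 2 * dif r k + 2 * inc (k + r)%N @[k --> \oo] --> (0 : R).
    have u1 : 2 * dif r k @[k --> \oo] --> (2 * 0 : R) by exact: cvgMl_tmp.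
    have u2 : 2 * inc (k + r)%N @[k --> \oo] --> (2 * 0 : R) by exact: cvgMl_tmp.
    by have := cvgD u1 u2; rewrite !mulr0 addr0; exact.
  apply: (squeeze_cvgr _ (@cvg_cst _ 0 _ _ _) ub); apply: nearW => k; apply/andP; split.
    by apply: sumr_ge0 => i _; exact: nsq_ge0.
  rewrite !mulr_sumr -big_split; apply: ler_sum => i _ /=.
  have -> : err k om i - err (k + r.+1)%N om i =
    (err k om i - err (k + r)%N om i) - (err (k + r).+1 om i - err (k + r)%N om i).
    by rewrite addnS [X in _ = _ + X]opprB addrA subrK.
  exact: nsqB_le.
pose eta k := 2 * c1 * c2 * \sum_(r < n + p) dif r k.
have eta0 : eta k @[k --> \oo] --> (0 : R).
  rewrite -[X in _ --> X](mulr0 (2 * c1 * c2)); apply: cvgMl_tmp.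
  rewrite -[X in _ --> X](_ : \sum_(r < n + p) (0 : R) = 0); last by rewrite big1.
  by apply: cvg_big => [|r _]; [exact: add_continuous|exact: dif0].
rewrite (_ : 0 = limn (lyap^~ om)) //.
symmetry; apply: (@excitation_limit0 _ (lyap^~ om) E eta z (2 * c1) Cz (limn (lyap^~ om)) (n +
  p)) => //.
- by move=> k; exact: energy_ge0.
- by rewrite mulr_ge0.
(* Coercivity needs one family of vectors for the whole window, here the errors at time [k].
   Replacing them by the errors at time [k + r] costs [dif r k], which is collected in [eta]. The
   window starts at [k.+1] because [E k] belongs to the step towards that time. *)
- move=> k; apply: le_trans (coer k.+1 (err k om) isT) _.
  rewrite /eta [2 * c1]mulrC -!mulrA -mulrDr ler_wpM2l//.
  rewrite !mulr_sumr -big_split/=; apply: ler_sum => r _.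
  apply: le_trans (energyD_le a_ge0 _ _ _ (err (k + r)%N om)) _.
  rewrite addSn lerD2l ler_wpM2l//.
  exact: eub.
- by move=> k; exact: lyap_ge0.
Qed.

End Path.

End Algorithm.

(** * The noise series *)

(** The indicator of [A] is absorbed into the weight, so a martingale difference remains one after
    multiplication by a bounded predictable factor. *)
Lemma integral_weight_on (d : measure_display) (T : measurableType d) (R : realType)
    (P : {measure set T -> \bar R}) (G : set (set T)) (X : T -> R)
    (Y : g_sigma_algebraType G -> R) (C : R) : G `<=` measurable ->
  P.-integrable setT (EFin \o X) ->
  (forall A, <<s G >> A -> (\int[P]_(x in A) (X x)%:E = 0)%E) ->
  measurable_fun setT Y -> (forall x, `|Y x| <= C) ->
  forall A, <<s G >> A -> (\int[P]_(x in A) (Y x * X x)%:E = 0)%E.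
Proof.
move=> sG iX X0 mY YC A mA.
have C0 : 0 <= C by exact: le_trans (normr_ge0 _) (YC point).
rewrite integral_mkcond.
transitivity (\int[P]_x (((\1_(A : set (g_sigma_algebraType G)) x : R) * Y x) * X x)%:E)%E.
  apply: eq_integral => x _; rewrite patchE indicE; case: (x \in A); first by rewrite mul1r.
  by rewrite !mul0r.
apply: (@integral_bounded_weight _ _ _ P G sG X (fun x => \1_(A : set (g_sigma_algebraType G)) x
  * Y x) C) => //.
  by apply: measurable_funM => //; exact: measurable_indic.
move=> x; rewrite normrM indicE; case: (_ \in _); rewrite ?normr1 ?mul1r// normr0 mul0r//.
Qed.

(** * Adaptedness of the estimates *)

Section Measurability.
Context (dsp : measure_display) (Omega : measurableType dsp) (R : realType).
Context (P : probability Omega R) (N n : nat) (m : 'I_N -> nat) (a : 'M[R]_N).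
Context (nu b : 'I_N -> 'I_N -> R) (alpha : 'I_N -> 'I_N -> nat -> R) (beta : 'I_N -> nat -> R).
Context (H : forall i : 'I_N, nat -> 'M[R]_(m i, n)) (theta : 'cV[R]_n).
Context (theta0 : 'I_N -> 'cV[R]_n).
Context (w : forall i : 'I_N, nat -> Omega -> 'cV[R]_(m i)) (d : 'I_N -> nat -> Omega -> R).
Context (a_ge0 : forall i j, 0 <= a i j).

Local Notation F k := (g_sigma_algebraType (gen_wd w d k)).
Local Notation est := (est a nu b alpha beta H theta theta0 w d).
Local Notation err := (err a nu b alpha beta H theta theta0 w d).
Local Notation lyap := (lyap a nu b alpha beta H theta theta0 w d).
Local Notation probe := (probe a nu b alpha beta H theta theta0 w d).
Local Notation received := (received a nu b alpha beta H theta theta0 w d).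
Local Notation bit_noise := (bit_noise a nu b alpha beta H theta theta0 w d).
Local Notation innovation := (innovation a nu b alpha beta H theta theta0 w d).

(** The type [F k] is a copy of [Omega] that carries the sigma-algebra $\mathcal{F}_k$ instead of
    the full one. *)
Definition adapted k (f : Omega -> R) := measurable_fun setT (f : F k -> R).

Lemma adaptedS k f : adapted k f -> adapted k.+1 f.
Proof. by move=> mf _ B mB; apply: gen_wd_nd; exact: mf. Qed.

Lemma adapted_quantized c k f : adapted k f -> adapted k (fun om => quantized c (f om)).
Proof.
move=> mf; apply: measurable_fun_ifT; last exact: measurable_cst.
  by apply: measurable_fun_ltr => //; exact: measurableT_comp.
by apply: measurable_fun_ifT => //; exact: measurable_fun_ltr.
Qed.

Lemma adapted_mean_bit t k i j f : adapted k f ->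
  adapted k (fun om => mean_bit nu b t i j (f om)).
Proof.
move=> mf; apply: measurable_funB; apply: measurableT_comp; try exact: measurable_lap_cdf.
  by apply: measurable_funM => //; exact: measurable_funB.
by apply: measurable_funM => //; apply: measurable_funB => //; exact: measurableT_comp.
Qed.

Lemma adapted_est k i r : adapted k (fun om => est k om i r 0).
Proof.
elim: k i r => [|k IH] i r; first exact: measurable_cst.
have IHS j s : adapted k.+1 (fun om => est k om j s 0) by exact: adaptedS.
have mp j : adapted k.+1 (fun om => probe k om j).
  by apply: measurable_sum => s; apply: measurable_funM => //; exact: IHS.
have mi : adapted k.+1 (fun om => innovation k om i).
  apply: measurable_sum => j; apply: measurable_funM => //; apply: measurable_funB.
    apply: adapted_quantized; apply: measurable_funD; first exact: mp.
    by apply: measurable_funM => //; exact: measurable_d_gen.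
  by apply: adapted_mean_bit; exact: mp.
have E om : est k.+1 om i r 0 = est k om i r 0 + innovation k om i * (phi n k.+1 : 'cV[R]_n) r 0 +
    beta i k.+1 * \sum_s (H i k.+1)^T r s * ((H i k.+1 *m theta) s 0 + w i k.+1 om s 0 -
      \sum_q H i k.+1 s q * est k om i q 0).
  rewrite est_step// mxE; congr (_ + _); first by rewrite mxE; congr (_ + _); rewrite mxE.
  rewrite mxE; congr (_ * _); rewrite mxE; apply: eq_bigr => s _; congr (_ * _).
  by rewrite mxE; congr (_ + _); rewrite mxE//; congr (- _); rewrite mxE.
rewrite /adapted; under eq_fun do rewrite E.
apply: measurable_funD.
  by apply: measurable_funD; [exact: IHS|apply: measurable_funM; [exact: mi|]].
apply: measurable_funM => //; apply: measurable_sum => s; apply: measurable_funM => //.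
apply: measurable_funB; first by apply: measurable_funD => //; exact: measurable_w_gen.
by apply: measurable_sum => q; apply: measurable_funM => //; exact: IHS.
Qed.

Lemma adapted_err k i r : adapted k (fun om => err k om i r 0).
Proof.
rewrite /adapted; under eq_fun do rewrite !mxE.
by apply: measurable_funB => //; exact: adapted_est.
Qed.

Lemma adapted_lyap k : adapted k (lyap k).
Proof.
apply: measurable_sum => i; apply: measurable_sum => r; apply: measurable_funX.
exact: adapted_err.
Qed.

Lemma adapted_dotv k i (u : 'cV[R]_n) : adapted k (fun om => dotv u (err k om i)).
Proof. by apply: measurable_sum => r; apply: measurable_funM => //; exact: adapted_err. Qed.

Lemma adapted_probe k j : adapted k (fun om => probe k om j).
Proof. by apply: measurable_sum => r; apply: measurable_funM => //; exact: adapted_est. Qed.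

Lemma adapted_bit_noise k j i : adapted k.+1 (fun om => bit_noise k om j i).
Proof.
apply: measurable_funB; last by apply: adapted_mean_bit; apply: adaptedS; exact: adapted_probe.
apply: adapted_quantized; apply: measurable_funD; first by apply: adaptedS; exact: adapted_probe.
by apply: measurable_funM => //; exact: measurable_d_gen.
Qed.

Lemma lyap1_gt0 k om : 0 < 1 + lyap k om.
Proof. by apply: ltr_pwDl => //; exact: lyap_ge0. Qed.

Lemma adapted_ratio k (f : Omega -> R) : adapted k f -> adapted k (fun om => f om / (1 + lyap k
  om)).
Proof.
move=> mf; apply: measurable_funM => //.
have h : adapted k (fun om => 1 + lyap k om).
  by apply: measurable_funD => //; exact: adapted_lyap.
have -> : (fun om => (1 + lyap k om)^-1) = (fun om => (1 + lyap k om) `^ (-1)).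
  by apply/funext => om; rewrite powR_inv1// ltW// lyap1_gt0.
have mpow : measurable_fun setT (fun x : R => x `^ (-1)) by exact: measurable_powR.
exact: (measurableT_comp mpow h).
Qed.

End Measurability.

Lemma integral_le_cst (d : measure_display) (T : measurableType d) (R : realType)
    (P : probability T R) (f : T -> R) (C : R) :
  measurable_fun setT f -> (forall x, 0 <= f x <= C) -> (\int[P]_x (f x)%:E <= C%:E)%E.
Proof.
move=> mf fC; rewrite -[leRHS]mule1 -(@probability_setT _ _ _ P) -integral_cst//.
apply: ge0_le_integral => //.
- by move=> x _; rewrite lee_fin; case/andP: (fC x).
- exact/measurable_EFinP.
- by move=> x _; rewrite lee_fin; case/andP: (fC x).
Qed.

(** The series and the integral are exchanged, so the full sum has integral at most [B] and is
    finite almost everywhere. *)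
Lemma ae_bounded_partial_sums (d : measure_display) (T : measurableType d) (R : realType)
    (P : {measure set T -> \bar R}) (f : nat -> T -> R) (v : nat -> R) :
  (forall t, measurable_fun setT (f t)) -> (forall t x, 0 <= f t x) ->
  (forall t, (\int[P]_x (f t x)%:E <= (v t)%:E)%E) ->
  (exists B, forall k, \sum_(t < k) v t <= B) ->
  {ae P, forall x, exists B, forall k, \sum_(t < k) f t x <= B}.
Proof.
move=> mf f0 fv [B hB].
pose S x := (\sum_(0 <= t <oo) (f t x)%:E)%E.
have mS : measurable_fun setT S.
  by apply: ge0_emeasurable_sum => *; [rewrite lee_fin|exact/measurable_EFinP].
have S0 x : (0 <= S x)%E by apply: nneseries_ge0 => t _ _; rewrite lee_fin.
have iS : P.-integrable setT S.
  apply/integrableP; split => //.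
  under eq_integral do rewrite gee0_abs//.
  have mfE t : measurable_fun setT (fun x => (f t x)%:E) by exact/measurable_EFinP.
  rewrite /S integral_nneseries//; last by move=> t x _; rewrite lee_fin.
  apply: (@le_lt_trans _ _ B%:E); last exact: ltry.
  apply: lime_le; first by apply: is_cvg_nneseries => t _ _; apply: integral_ge0 => x _;
    rewrite lee_fin.
  apply: nearW => k; rewrite big_mkord; apply: le_trans (_ : ((\sum_(t < k) v t)%:E <= _)%E);
    last by rewrite lee_fin.
  by rewrite -sumEFin; apply: lee_sum => t _; exact: fv.
apply: filterS (integrable_ae measurableT iS) => x /(_ I) fin.
exists (fine (S x)) => k; rewrite -lee_fin fineK// -sumEFin.
rewrite -(big_mkord xpredT (fun t => (f t x)%:E)).
by apply: nneseries_lim_ge => t _ _; rewrite lee_fin.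
Qed.

Section NoiseSeries.
Context (dsp : measure_display) (Omega : measurableType dsp) (R : realType).
Context (P : probability Omega R) (N n : nat) (m : 'I_N -> nat) (a : 'M[R]_N).
Context (nu b : 'I_N -> 'I_N -> R) (alpha : 'I_N -> 'I_N -> nat -> R) (beta : 'I_N -> nat -> R).
Context (H : forall i : 'I_N, nat -> 'M[R]_(m i, n)) (theta : 'cV[R]_n).
Context (theta0 : 'I_N -> 'cV[R]_n).
Context (w : forall i : 'I_N, nat -> Omega -> 'cV[R]_(m i)) (d : 'I_N -> nat -> Omega -> R).
Context (a_sym : forall i j, a i j = a j i) (a_ge0 : forall i j, 0 <= a i j).
Context (nu_ge0 : forall i j, 0 < a i j -> 0 <= nu i j).
Context (b_gt0 : forall i j, 0 < a i j -> 0 < b i j).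
Context (w_meas : forall i k (c : 'I_(m i)), (1 <= k)%N ->
     measurable_fun setT (fun om => w i k om c 0)).
Context (d_meas : forall i k, (1 <= k)%N -> measurable_fun setT (d i k)).
Context (d_lap : forall i k (x : R), (1 <= k)%N ->
     P [set om | d i k om <= x] = (lap_cdf x)%:E).
Context (d_indep : forall (s : seq ('I_N * nat)) (B : 'I_N -> nat -> set R) (A : set Omega),
     uniq s -> all (fun q => (1 <= q.2)%N) s ->
     (forall i k, measurable (B i k)) -> <<s gen_w_all w >> A ->
     P (A `&` \big[setI/setT]_(q <- s) (d q.1 q.2 @^-1` B q.1 q.2))
     = (P A * \prod_(q <- s) P (d q.1 q.2 @^-1` B q.1 q.2))%E).

Local Notation F k := (g_sigma_algebraType (gen_wd w d k)).
Local Notation err := (err a nu b alpha beta H theta theta0 w d).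
Local Notation lyap := (lyap a nu b alpha beta H theta theta0 w d).
Local Notation probe := (probe a nu b alpha beta H theta theta0 w d).
Local Notation bit_noise := (bit_noise a nu b alpha beta H theta theta0 w d).
Local Notation gain := (gain a alpha).
Local Notation adapted := (adapted w d).

Let sG k : gen_wd w d k `<=` measurable := @gen_wd_measurable _ _ _ _ _ _ _ w_meas d_meas k.

Let adapted_measurable k f : adapted k f -> measurable_fun setT f.
Proof. exact: (@measurable_g_sigma _ _ _ _ _ _ (@sG k)). Qed.

Lemma bit_noise_bound k om j i : `|bit_noise k om j i| <= 2.
Proof.
apply: le_trans (ler_normB _ _) _; have := mean_bit_bound nu b k j i (probe k om j).
by have := received_bound a nu b alpha beta H theta theta0 w d k om j i; lra.
Qed.

Lemma integral_bit_noise k i j A : 0 < a i j -> <<s gen_wd w d k >> A ->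
  (\int[P]_(om in A) (bit_noise k om j i)%:E = 0)%E.
Proof.
move=> e mA; have e' : 0 < a j i by rewrite a_sym.
have C0 : 0 <= threshold nu b k j i.
  by apply: mulr_ge0; [apply: mulr_ge0; [exact: nu_ge0|exact: ltW (b_gt0 e')]|rewrite ln_ge0//
    ler1n].
apply: (@integral_dither _ _ _ P _ (@sG k) (d j k.+1)) => //.
- exact: d_meas.
- by move=> A' B; exact: dither_indep.
- by move=> x; exact: d_lap.
- exact: adapted_probe.
- exact: b_gt0.
Qed.

(** From [2 |y| <= 1 + y^2]. This is what dividing by [1 + V] achieves: the weights are bounded
    however large [V] is. *)
Lemma ratio_bound (y V C : R) : 0 <= V -> 1 <= C -> y ^+ 2 <= C * V -> `|y / (1 + V)| <= C.
Proof.
move=> V0 C1 yV; have V1 : 0 < 1 + V by apply: ltr_pwDl.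
rewrite normrM (gtr0_norm (_ : 0 < (1 + V)^-1)) ?invr_gt0// ler_pdivrMr//.
rewrite ler_norml; have := sqr_ge0 (y - 1); have := sqr_ge0 (y + 1).
by move: yV; rewrite !expr2; nra.
Qed.

(** The weight is at most 1 and the bit noise at most 2, which gives the second moments
    [4 * gain^2]. *)
Lemma bit_series_cvg i j : 0 < a i j ->
  (exists B, forall k, \sum_(t < k) gain t i j ^+ 2 <= B) ->
  {ae P, forall om, cvgn (fun k => \sum_(t < k) gain t i j * bit_noise t om j i *
    (dotv (phi n t.+1) (err t om i) / (1 + lyap t om)))}.
Proof.
move=> e gB.
pose rat t om := dotv (phi n t.+1) (err t om i) / (1 + lyap t om).
have mrat t : adapted t (rat t) by apply: adapted_ratio => //; exact: adapted_dotv.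
have rat1 t om : `|rat t om| <= 1.
  apply: ratio_bound => //; first exact: lyap_ge0.
  by rewrite mul1r; apply: le_trans (phi_dot_sqr _ _) _; exact: err_nsq_le.
have mbit t : adapted t.+1 (fun om => bit_noise t om j i) by exact: adapted_bit_noise.
have mbitT t : measurable_fun setT (fun om => bit_noise t om j i) by exact: adapted_measurable.
have mX t : adapted t.+1 (fun om => gain t i j * bit_noise t om j i * rat t om).
  apply: measurable_funM; last exact: adaptedS (mrat t).
  by apply: measurable_funM => //; exact: mbit.
apply: (@martingale_series_cvg _ _ _ P (gen_wd w d) sG (@gen_wd_nd _ _ _ _ _ w d)
  (fun t om => gain t i j * bit_noise t om j i * rat t om) mX _ (fun t => 4 * gain t i j ^+ 2)).
- move=> t A mA.
  transitivity (\int[P]_(om in A) (gain t i j * rat t om * bit_noise t om j i)%:E)%E.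
    by apply: eq_integral => om _; rewrite mulrAC.
  apply: (@integral_weight_on _ _ _ P _ (fun om => bit_noise t om j i)
    (fun om => gain t i j * rat t om) `|gain t i j| (@sG t)) => //.
  + rewrite (_ : EFin \o _ = (fun om => (bit_noise t om j i * 1)%:E)); last first.
      by apply/funext => om; rewrite mulr1.
    apply: (@integrable_bounded_mul _ _ _ P (cst 1) (fun om => bit_noise t om j i) 2) => //.
      by move=> om; exact: bit_noise_bound.
    exact: finite_measure_integrable_cst.
  + by move=> A' mA'; exact: integral_bit_noise.
  + by apply: measurable_funM => //; exact: mrat.
  + by move=> om; rewrite normrM ler_piMr.
- move=> t; apply: integral_le_cst.
    by apply: measurable_funX; exact: adapted_measurable (mX t).
  move=> om; rewrite sqr_ge0 /=; have := bit_noise_bound t om j i; have := rat1 t om.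
  move: (gain t i j) (bit_noise t om j i) (rat t om) => g u v h2 h1.
  rewrite !exprMn -mulrA [leRHS]mulrC ler_wpM2l ?sqr_ge0//.
  rewrite -(real_normK (num_real u)) -(real_normK (num_real v)).
  rewrite -exprMn (_ : 4 = 2 ^+ 2 :> R); last by rewrite expr2; lra.
  rewrite lerXn2r ?nnegrE ?mulr_ge0//.
  by have := ler_pM (normr_ge0 _) (normr_ge0 _) h1 h2; rewrite mulr1.
- exact: (@bounded_partial_sumsZ R (fun t => gain t i j ^+ 2) 4 (ler0n _ _) gB).
Qed.

Context (A2_mds : forall i k (c : 'I_(m i)), (1 <= k)%N ->
     P.-integrable setT (fun om => (w i k om c 0)%:E) /\
     forall A : set Omega, <<s gen_w w k.-1 `|` gen_d d k.-1 >> A ->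
       (\int[P]_(om in A) (w i k om c 0)%:E = 0)%E).
Context (rho : R) (rho_gt2 : 2 < rho) (M : 'I_N -> nat -> Omega -> \bar R).
Context (M_meas : forall (i : 'I_N) k (B : set (\bar R)), (1 <= k)%N -> measurable B ->
          <<s gen_w w k.-1 >> (M i k @^-1` B)).
Context (M_int : forall (i : 'I_N) k (A : set Omega), (1 <= k)%N -> <<s gen_w w k.-1 >> A ->
          (\int[P]_(om in A) ((vnorm (w i k om)) `^ rho)%:E
           = \int[P]_(om in A) M i k om)%E).
Context (c : R) (c_gt0 : 0 < c).
Context (H_le : forall i k x, (1 <= k)%N -> nsq (H i k *m x) <= c * nsq x).

(* The conditional moments are only pathwise bounded, hence this truncation. *)
Definition moment_le (K : nat) i t : set Omega := M i t.+1 @^-1` [set y | (y <= K%:R%:E)%E].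

Let moment_le_gen K i t : <<s gen_w w t >> (moment_le K i t).
Proof.
have := @M_meas i t.+1 [set y | (y <= K%:R%:E)%E] isT; apply.
by have := @emeasurable_itv R `]-oo, K%:R%:E]; rewrite set_itvE; exact.
Qed.

Let moment_le_wd K i t : <<s gen_wd w d t >> (moment_le K i t).
Proof.
have s : gen_w w t `<=` gen_wd w d t by left.
exact: (sub_smallest2r (smallest_sigma_algebra _ _) s).
Qed.

Let moment_le_measurable K i t : measurable (moment_le K i t).
Proof. exact: (sub_g_sigma (@sG t)). Qed.

Let measurable_nsq_w i t : measurable_fun setT (fun om => nsq (w i t.+1 om)).
Proof. by apply: measurable_sum => r; apply: measurable_funX; exact: w_meas. Qed.

Let measurable_moment i t : measurable_fun setT (fun om => vnorm (w i t.+1 om) `^ rho).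
Proof.
apply: (measurableT_comp (measurable_powR rho)).
rewrite (_ : (fun om => _) = (fun om => nsq (w i t.+1 om) `^ 2^-1)).
  exact: (measurableT_comp (measurable_powR 2^-1)).
by apply/funext => om; rewrite powR12_sqrt// nsq_ge0.
Qed.

(** The truncation event belongs to the past of [w], so the defining property of [M] applies on it.
    The sign of a version [M] is not prescribed, hence the passage to its positive part. *)
Lemma integral_moment_le K i t :
  (\int[P]_(om in moment_le K i t) ((vnorm (w i t.+1 om)) `^ rho)%:E <= K%:R%:E)%E.
Proof.
rewrite (@M_int i t.+1)// integralE.
have mM : measurable_fun setT (M i t.+1).
  move=> _ B mB; rewrite setTI; apply: (sub_g_sigma (@gen_w_measurable _ _ _ _ _ _ w_meas t)).
  exact: (@M_meas i t.+1).
have mA := moment_le_measurable K i t.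
apply: (@le_trans _ _ (\int[P]_(om in moment_le K i t) (M i t.+1)^\+ om)%E).
  by apply: geeDl; rewrite oppe_le0; apply: integral_ge0.
apply: (@le_trans _ _ (\int[P]_(om in moment_le K i t) cst K%:R%:E om)%E).
  apply: ge0_le_integral => //.
    by apply: measurable_funepos; exact: measurable_funS mM.
  by move=> om h; rewrite funeposE ge_max h/= lee_fin.
rewrite integral_cst// -[leRHS]mule1; apply: lee_wpmul2l; first by rewrite lee_fin.
exact: probability_le1.
Qed.

Lemma nsq_le_moment q (v : 'cV[R]_q) : nsq v <= 1 + vnorm v `^ rho.
Proof.
rewrite -vnorm_sqr; have v0 : 0 <= vnorm v by rewrite sqrtr_ge0.
have [v1|v1] := leP (vnorm v) 1.
  have : vnorm v ^+ 2 <= 1 by rewrite expr_le1.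
  by have := powR_ge0 (vnorm v) rho; lra.
rewrite -powR_mulrn//; have := @ler_powR R (vnorm v) (ltW v1) _ _ (ltW rho_gt2).
lra.
Qed.

Definition truncated K i t (om : Omega) : R := \1_(moment_le K i t) om.

Let truncated01 K i t om : 0 <= truncated K i t om <= 1.
Proof. by rewrite /truncated indicE; case: (_ \in _); rewrite ?lexx ?ler01. Qed.

Lemma integral_truncated_nsq K i t :
  (\int[P]_om (truncated K i t om * nsq (w i t.+1 om))%:E <= (1 + K%:R)%:E)%E.
Proof.
have mA := moment_le_measurable K i t.
have m1 : measurable_fun setT (truncated K i t) by exact: measurable_indic.
apply: (@le_trans _ _ (\int[P]_om ((truncated K i t om)%:E +
    (truncated K i t om * vnorm (w i t.+1 om) `^ rho)%:E))%E).
  apply: ge0_le_integral => //.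
  - by move=> om _; rewrite lee_fin mulr_ge0 ?nsq_ge0//; case/andP: (truncated01 K i t om).
  - by apply/measurable_EFinP; exact: measurable_funM.
  - by apply: emeasurable_funD; apply/measurable_EFinP => //; exact: measurable_funM.
  - move=> om _; rewrite -EFinD lee_fin -[X in X + _]mulr1 -mulrDr ler_wpM2l ?nsq_le_moment//.
have e1 om : setT om -> (0 <= (truncated K i t om)%:E)%E.
  by rewrite lee_fin; case/andP: (truncated01 K i t om).
have e2 om : setT om -> (0 <= (truncated K i t om * vnorm (w i t.+1 om) `^ rho)%:E)%E.
  by rewrite lee_fin mulr_ge0 ?powR_ge0//; case/andP: (truncated01 K i t om).
have e3 : measurable_fun setT (fun om => (truncated K i t om)%:E) by exact/measurable_EFinP.
have e4 : measurable_fun setT (fun om => (truncated K i t om * vnorm (w i t.+1 om) `^ rho)%:E).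
  by apply/measurable_EFinP; exact: measurable_funM.
rewrite ge0_integralD// EFinD; apply: leeD; first exact: integral_le_cst.
apply: le_trans (integral_moment_le K i t); rewrite [leRHS]integral_mkcond.
rewrite le_eqVlt; apply/orP; left; apply/eqP; apply: eq_integral => om _.
by rewrite patchE /truncated indicE; case: (_ \in _); rewrite ?mul1r ?mul0r.
Qed.

Lemma truncated_energy_sum K i :
  (exists B, forall k, \sum_(t < k) beta i t.+1 ^+ 2 <= B) ->
  {ae P, forall om, exists B, forall k,
    \sum_(t < k) beta i t.+1 ^+ 2 * (truncated K i t om * nsq (w i t.+1 om)) <= B}.
Proof.
move=> bB.
have m1 t : measurable_fun setT (fun om => truncated K i t om * nsq (w i t.+1 om)).
  by apply: measurable_funM => //; exact: measurable_indic.
have p1 t om : 0 <= truncated K i t om * nsq (w i t.+1 om).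
  by rewrite mulr_ge0 ?nsq_ge0//; case/andP: (truncated01 K i t om).
apply: (@ae_bounded_partial_sums _ _ _ P
  (fun t om => beta i t.+1 ^+ 2 * (truncated K i t om * nsq (w i t.+1 om)))
  (fun t => (1 + K%:R) * beta i t.+1 ^+ 2)).
- by move=> t; exact: measurable_funM.
- by move=> t om; rewrite mulr_ge0 ?sqr_ge0.
- move=> t; under eq_integral do rewrite EFinM.
  have e1 : measurable_fun setT (fun om => (truncated K i t om * nsq (w i t.+1 om))%:E).
    exact/measurable_EFinP.
  have e2 om : setT om -> (0 <= (truncated K i t om * nsq (w i t.+1 om))%:E)%E.
    by rewrite lee_fin.
  rewrite ge0_integralZl// ?lee_fin ?sqr_ge0//.
  have -> : ((1 + K%:R) * beta i t.+1 ^+ 2)%:E = ((beta i t.+1 ^+ 2)%:E * (1 + K%:R)%:E)%E.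
    by rewrite -EFinM mulrC.
  apply: lee_wpmul2l; first by rewrite lee_fin sqr_ge0.
  exact: integral_truncated_nsq.
- by apply: (@bounded_partial_sumsZ R (fun t => beta i t.+1 ^+ 2)) => //; rewrite addr_ge0.
Qed.

(** Truncation depends on the past only, so it is one more bounded predictable weight; it also turns
    the random moment bound into the number [1 + K], as [rho > 2] bounds the square by 1 plus the
    power. *)
Lemma obs_series_cvg K i (r : 'I_(m i)) :
  (exists B, forall k, \sum_(t < k) beta i t.+1 ^+ 2 <= B) ->
  {ae P, forall om, cvgn (fun k => \sum_(t < k) beta i t.+1 * (truncated K i t om * w i t.+1 om r
    0) *
    ((H i t.+1 *m err t om i) r 0 / (1 + lyap t om)))}.
Proof.
move=> bB.
pose rat t om := (H i t.+1 *m err t om i) r 0 / (1 + lyap t om).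
have mrat t : adapted t (rat t).
  apply: adapted_ratio => //; rewrite /adapted; under eq_fun do rewrite mxE.
  by apply: measurable_sum => q; apply: measurable_funM => //; exact: adapted_err.
pose C := 1 + c; have C1 : 1 <= C by rewrite lerDl ltW.
have ratC t om : `|rat t om| <= C.
  apply: ratio_bound => //; first exact: lyap_ge0.
  apply: le_trans (coord_sqr_le _ _) _; apply: le_trans (H_le _ _ _) _ => //.
  have := err_nsq_le a nu b alpha beta H theta theta0 w d t om i.
  have := lyap_ge0 a nu b alpha beta H theta theta0 w d t om => h0 h1.
  by have := ler_wpM2l (ltW c_gt0) h1; rewrite /C; lra.
have mtr t : adapted t (truncated K i t).
  have mA : measurable (moment_le K i t : set (F t)) by exact: moment_le_wd.
  have h : measurable_fun setT (\1_(moment_le K i t : set (F t)) : F t -> R) by exact: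
    measurable_indic.
  exact: h.
have mw t : adapted t.+1 (fun om => w i t.+1 om r 0) by exact: measurable_w_gen.
have mX t : adapted t.+1 (fun om => beta i t.+1 * (truncated K i t om * w i t.+1 om r 0) * rat t
  om).
  apply: measurable_funM; last exact: adaptedS (mrat t).
  apply: measurable_funM => //; apply: measurable_funM; [exact: adaptedS (mtr t)|exact: mw].
apply: (@martingale_series_cvg _ _ _ P (gen_wd w d) sG (@gen_wd_nd _ _ _ _ _ w d)
  (fun t om => beta i t.+1 * (truncated K i t om * w i t.+1 om r 0) * rat t om) mX _
  (fun t => (C ^+ 2 * (1 + K%:R)) * beta i t.+1 ^+ 2)).
- move=> t A mA.
  transitivity (\int[P]_(om in A) ((beta i t.+1 * truncated K i t om * rat t om) * w i t.+1 om r
    0)%:E)%E.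
    by apply: eq_integral => om _; congr EFin; ring.
  have [iw w0] := @A2_mds i t.+1 r isT.
  apply: (@integral_weight_on _ _ _ P _ (fun om => w i t.+1 om r 0)
    (fun om => beta i t.+1 * truncated K i t om * rat t om) (`|beta i t.+1| * C) (@sG t)) => //.
  + apply: measurable_funM; last exact: mrat.
    by apply: measurable_funM => //; exact: mtr.
  + move=> om; rewrite 2!normrM; apply: ler_pM => //.
    by rewrite ler_piMr// ger0_norm; case/andP: (truncated01 K i t om).
- move=> t; apply: (@le_trans _ _ (\int[P]_om ((C ^+ 2 * beta i t.+1 ^+ 2) *
      (truncated K i t om * nsq (w i t.+1 om)))%:E)%E).
    apply: ge0_le_integral => //.
    + by move=> om _; rewrite lee_fin sqr_ge0.
    + by apply/measurable_EFinP; apply: measurable_funX; exact: adapted_measurable (mX t).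
    + apply/measurable_EFinP; apply: measurable_funM => //; apply: measurable_funM => //.
      exact: measurable_indic.
    + move=> om _; rewrite lee_fin; have := ratC t om; have := coord_sqr_le (w i t.+1 om) r.
      have tr2 : truncated K i t om ^+ 2 = truncated K i t om.
        by rewrite /truncated indicE; case: (_ \in _); rewrite ?expr1n ?expr0n.
      have t0 : 0 <= truncated K i t om by case/andP: (truncated01 K i t om).
      move: (beta i t.+1) (w i t.+1 om r 0) (rat t om) (truncated K i t om) tr2 t0.
      move=> be y v tt tr2 t0 h1 h2; rewrite !exprMn tr2.
      have h3 : v ^+ 2 <= C ^+ 2.
        rewrite -(real_normK (num_real v)) lerXn2r// nnegrE//; lra.
      rewrite (_ : be ^+ 2 * (tt * y ^+ 2) * v ^+ 2 = (be ^+ 2 * tt) * (y ^+ 2 * v ^+ 2));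
        last by ring.
      rewrite (_ : C ^+ 2 * be ^+ 2 * _ = (be ^+ 2 * tt) * (nsq (w i t.+1 om) * C ^+ 2));
        last by ring.
      apply: ler_wpM2l; first by rewrite mulr_ge0 ?sqr_ge0.
      by apply: ler_pM; rewrite ?sqr_ge0.
  under eq_integral do rewrite EFinM.
  have e1 : measurable_fun setT (fun om => (truncated K i t om * nsq (w i t.+1 om))%:E).
    by apply/measurable_EFinP; apply: measurable_funM => //; exact: measurable_indic.
  have e2 om : setT om -> (0 <= (truncated K i t om * nsq (w i t.+1 om))%:E)%E.
    by rewrite lee_fin mulr_ge0 ?nsq_ge0//; case/andP: (truncated01 K i t om).
  have q0 : (0 <= (C ^+ 2 * beta i t.+1 ^+ 2)%:E)%E.
    by rewrite lee_fin; apply: mulr_ge0; exact: sqr_ge0.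
  rewrite ge0_integralZl//.
  have -> : (C ^+ 2 * (1 + K%:R) * beta i t.+1 ^+ 2)%:E =
      ((C ^+ 2 * beta i t.+1 ^+ 2)%:E * (1 + K%:R)%:E)%E.
    by rewrite -EFinM mulrAC.
  apply: lee_wpmul2l => //.
  exact: integral_truncated_nsq.
- apply: (@bounded_partial_sumsZ R (fun t => beta i t.+1 ^+ 2) (C ^+ 2 * (1 + K%:R))) => //.
  by rewrite mulr_ge0 ?sqr_ge0// addr_ge0.
Qed.

End NoiseSeries.

(** * Almost sure convergence of the estimates *)

Lemma eseries_bounded_partial_sums (R : realType) (f : nat -> R) : (forall k, 0 <= f k) ->
  (\sum_(1 <= k <oo) (f k)%:E < +oo)%E -> exists B, forall k, \sum_(t < k) f t.+1 <= B.
Proof.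
move=> f0 fin.
have S0 : (0 <= \sum_(1 <= k <oo) (f k)%:E)%E by apply: nneseries_ge0 => k _ _; rewrite lee_fin.
exists (fine (\sum_(1 <= k <oo) (f k)%:E)%E) => k.
rewrite -lee_fin fineK ?ge0_fin_numE// -sumEFin.
have -> : (\sum_(t < k) (f t.+1)%:E = \sum_(1 <= t < k.+1) (f t)%:E)%E.
  by rewrite big_add1 big_mkord.
by apply: nneseries_lim_ge => t _ _; rewrite lee_fin.
Qed.

Lemma eseries_unbounded_partial_sums (R : realType) (Z : nat -> \bar R) (z : nat -> R) :
  (forall k, Z k.+1 = (z k)%:E) -> (forall k, 0 <= z k) ->
  (\sum_(1 <= k <oo) Z k = +oo)%E -> ~ exists B, forall k, \sum_(t < k) z t <= B.
Proof.
move=> Zz z0 Zoo [B hB].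
suff : (\sum_(1 <= k <oo) Z k <= B%:E)%E by rewrite Zoo.
apply: lime_le.
  by apply: is_cvg_ereal_nneg_natsum => -[//|k] _; rewrite Zz lee_fin.
apply: nearW => -[|k]; first by rewrite big_geq// lee_fin; have := hB 0%N; rewrite big_ord0.
rewrite big_add1/= big_mkord; under eq_bigr do rewrite Zz.
by rewrite sumEFin lee_fin.
Qed.

(** The minimum is taken in the extended reals, an empty family giving [+oo]; a sensor is supplied
    so that its [beta] makes the minimum finite. The sequence [z] is shifted by one, its entry [k]
    being the minimum at time [k.+1]. *)
Lemma min_step_size (R : realType) (N : nat) (a : 'M[R]_N) (nu : 'I_N -> 'I_N -> R)
    (alpha : 'I_N -> 'I_N -> nat -> R) (beta : 'I_N -> nat -> R) : 'I_N ->
  (forall i j, 0 < a i j -> 0 <= nu i j) ->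
  (forall i j k, 0 < a i j -> (1 <= k)%N -> 0 < alpha i j k) ->
  (forall i k, (1 <= k)%N -> 0 < beta i k) ->
  (forall i j, 0 < a i j -> exists C : R, forall k, (1 <= k)%N -> alpha i j k.+1 / alpha i j k <=
    C) ->
  (forall i, exists C : R, forall k, (1 <= k)%N -> beta i k.+1 / beta i k <= C) ->
  (\sum_(1 <= k <oo)
     Order.min
       (\big[Order.min/+oo%E]_(i < N) \big[Order.min/+oo%E]_(j < N | (0 < a i j)%R)
          (alpha i j k / (k%:R `^ nu i j))%R%:E)
       (\big[Order.min/+oo%E]_(i < N) (beta i k)%:E) = +oo)%E ->
  exists (z : nat -> R) (C : R), [/\ forall k, 0 <= z k, 1 <= C /\ forall k, z k.+1 <= C * z k,
    forall i j k, 0 < a i j -> z k <= alpha i j k.+1 / (k.+1%:R `^ nu i j),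
    forall i k, z k <= beta i k.+1 & ~ exists B, forall k, \sum_(t < k) z t <= B].
Proof.
move=> i0 nu0 al0 be0 ral rbe Zoo.
pose Z k := Order.min
       (\big[Order.min/+oo%E]_(i < N) \big[Order.min/+oo%E]_(j < N | (0 < a i j)%R)
          (alpha i j k / (k%:R `^ nu i j))%R%:E)
       (\big[Order.min/+oo%E]_(i < N) (beta i k)%:E) : \bar R.
have le_Z x k : (forall i j, 0 < a i j -> (x <= (alpha i j k / (k%:R `^ nu i j))%:E)%E) ->
    (forall i, (x <= (beta i k)%:E)%E) -> (x <= Z k)%E.
  move=> h1 h2; rewrite le_min; apply/andP; split.
    apply: (big_ind (fun y => (x <= y)%E)) => [|u v|i _]; first exact: leey.
      by move=> xu xv; rewrite le_min xu xv.
    apply: (big_ind (fun y => (x <= y)%E)) => [|u v|j e]; first exact: leey.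
      by move=> xu xv; rewrite le_min xu xv.
    exact: h1.
  apply: (big_ind (fun y => (x <= y)%E)) => [|u v|i _]; first exact: leey.
    by move=> xu xv; rewrite le_min xu xv.
  exact: h2.
have Z_al i j k : 0 < a i j -> (Z k <= (alpha i j k / (k%:R `^ nu i j))%:E)%E.
  move=> e; rewrite /Z ge_min; apply/orP; left.
  by apply: le_trans (bigmin_le_cond _ _ (isT : xpredT i)) (bigmin_le_cond _ _ e).
have Z_be i k : (Z k <= (beta i k)%:E)%E.
  by rewrite /Z ge_min; apply/orP; right; exact: (bigmin_le_cond _ _ (isT : xpredT i)).
have Z0 k : (0 <= Z k.+1)%E.
  apply: le_Z => [i j e|i]; rewrite lee_fin; last exact: ltW (be0 _ _ _).
  by rewrite divr_ge0 ?powR_ge0// ltW// al0.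
pose z k := fine (Z k.+1).
have Zz k : Z k.+1 = (z k)%:E.
  by rewrite fineK// ge0_fin_numE// (le_lt_trans (Z_be i0 _)) ?ltry.
have z0 k : 0 <= z k by rewrite -lee_fin -Zz.
have /choice[Cal hal] : forall q : 'I_N * 'I_N, exists C : R, forall k, 0 < a q.1 q.2 ->
    (1 <= k)%N -> alpha q.1 q.2 k.+1 / alpha q.1 q.2 k <= C.
  move=> [i j] /=; have [e|ne] := boolP (0 < a i j); last by exists 0.
  by have [C hC] := ral i j e; exists C => k _; exact: hC.
have /choice[Cbe hbe] := rbe.
(* A single constant above 1 that dominates the ratio bounds of all edges and all sensors. *)
pose C := 1 + \sum_q `|Cal q| + \sum_i `|Cbe i|.
have S1 : 0 <= \sum_q `|Cal q| by apply: sumr_ge0 => q _.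
have S2 : 0 <= \sum_i `|Cbe i| by apply: sumr_ge0 => q _.
have C1 : 1 <= C by rewrite /C; lra.
have C_al q : Cal q <= C.
  apply: le_trans (ler_norm _) _.
  have : `|Cal q| <= \sum_q `|Cal q| by rewrite (bigD1 q)//= lerDl; apply: sumr_ge0.
  by rewrite /C; lra.
have C_be q : Cbe q <= C.
  apply: le_trans (ler_norm _) _.
  have : `|Cbe q| <= \sum_q `|Cbe q| by rewrite (bigD1 q)//= lerDl; apply: sumr_ge0.
  by rewrite /C; lra.
have C0 : 0 < C by lra.
exists z, C; split => //.
- split => // k; rewrite mulrC -ler_pdivrMr// -lee_fin -Zz; apply: le_Z => [i j e|i];
    rewrite lee_fin ler_pdivrMr//.
    have : z k.+1 <= alpha i j k.+2 / (k.+2%:R `^ nu i j) by rewrite -lee_fin -Zz Z_al.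
    move=> /le_trans; apply; rewrite mulrAC ler_pM ?invr_ge0 ?powR_ge0//.
    + exact: ltW (al0 _ _ _ _ _).
    + have := le_trans (hal (i, j) k.+1 e isT) (C_al (i, j)).
      by rewrite /= ler_pdivrMr ?al0// mulrC.
    (* As [nu >= 0], the factor [k^(-nu)] decreases in [k], so the ratio bound of [alpha] passes to
       the quotient. *)
    + rewrite lef_pV2 ?posrE ?powR_gt0// ge0_ler_powR ?nnegrE ?nu0// ler_nat//.
  have : z k.+1 <= beta i k.+2 by rewrite -lee_fin -Zz Z_be.
  move=> /le_trans; apply; have := le_trans (hbe i k.+1 isT) (C_be i).
  by rewrite ler_pdivrMr ?be0// mulrC.
- by move=> i j k e; rewrite -lee_fin -Zz Z_al.
- by move=> i k; rewrite -lee_fin -Zz Z_be.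
- exact: (@eseries_unbounded_partial_sums R Z).
Qed.

Lemma cvg_col_nsq (R : realType) (n : nat) (f : nat -> 'cV[R]_n) (v : 'cV[R]_n) :
  nsq (f k - v) @[k --> \oo] --> (0 : R) -> f k @[k --> \oo] --> v.
Proof.
move=> h; apply/cvg_ballP => e e0.
have e20 : 0 < e ^+ 2 by rewrite exprn_gt0.
have /cvgrPdist_lt/(_ _ e20)[K _ hK] := h.
exists K => // k /hK /=; rewrite sub0r normrN ger0_norm ?nsq_ge0// => lt_e.
split => // i j; rewrite ord1 /ball/= distrC -(ltr_pXn2r (n := 2)) ?nnegrE ?normr_ge0 ?(ltW e0)//.
rewrite real_normK ?num_real//; apply: le_lt_trans lt_e.
by have := coord_sqr_le (f k - v) i; rewrite !mxE.
Qed.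

Theorem theorem4p1
  (R : realType) (dsp : measure_display) (Omega : measurableType dsp)
  (P : probability Omega R)
  (N n : nat) (m : 'I_N -> nat)
  (* network *)
  (a : 'M[R]_N)
  (a_sym : forall i j, a i j = a j i)
  (a_ge0 : forall i j, 0 <= a i j)
  (a_noloop : forall i, a i i = 0)
  (* observations and noises *)
  (theta : 'cV[R]_n) (H : forall i : 'I_N, nat -> 'M[R]_(m i, n))
  (w : forall i : 'I_N, nat -> Omega -> 'cV[R]_(m i))
  (d : 'I_N -> nat -> Omega -> R)
  (* algorithm inputs *)
  (theta0 : 'I_N -> 'cV[R]_n) (nu b : 'I_N -> 'I_N -> R)
  (alpha : 'I_N -> 'I_N -> nat -> R) (beta : 'I_N -> nat -> R)
  (nu_sym : forall i j, 0 < a i j -> nu i j = nu j i)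
  (nu_ge0 : forall i j, 0 < a i j -> 0 <= nu i j)
  (b_sym : forall i j, 0 < a i j -> b i j = b j i)
  (b_gt0 : forall i j, 0 < a i j -> 0 < b i j)
  (alpha_sym : forall i j k, 0 < a i j -> (1 <= k)%N -> alpha i j k = alpha j i k)
  (alpha_gt0 : forall i j k, 0 < a i j -> (1 <= k)%N -> 0 < alpha i j k)
  (beta_gt0 : forall i k, (1 <= k)%N -> 0 < beta i k)
  (* (A1) *)
  (A1_bound : exists Hbar : R, 0 < Hbar /\
     forall i k, (1 <= k)%N -> opnorm_le (H i k) Hbar)
  (A1_pe : exists (p : nat) (delta : R), (0 < p)%N /\ 0 < delta /\
     forall k, (1 <= k)%N ->
       loewner_ge ((p%:R)^-1 *: \sum_(k <= t < k + p) \sum_(i < N) (H i t)^T *m H i t)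
                  (delta%:M))
  (* (A2) *)
  (w_meas : forall i k (c : 'I_(m i)), (1 <= k)%N ->
     measurable_fun setT (fun om => w i k om c 0))
  (A2_mds : forall i k (c : 'I_(m i)), (1 <= k)%N ->
     P.-integrable setT (fun om => (w i k om c 0)%:E) /\
     forall A : set Omega, <<s gen_w w k.-1 `|` gen_d d k.-1 >> A ->
       (\int[P]_(om in A) (w i k om c 0)%:E = 0)%E)
  (A2_moment : exists rho : R, 2 < rho /\
     exists M : 'I_N -> nat -> Omega -> \bar R,
       (* M i k is a version of E[ ||w_{i,k}||^rho | F^w_{k-1} ] *)
       (forall (i : 'I_N) k (B : set (\bar R)), (1 <= k)%N -> measurable B ->
          <<s gen_w w k.-1 >> (M i k @^-1` B)) /\
       (forall (i : 'I_N) k (A : set Omega), (1 <= k)%N -> <<s gen_w w k.-1 >> A ->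
          (\int[P]_(om in A) ((vnorm (w i k om)) `^ rho)%:E
           = \int[P]_(om in A) M i k om)%E) /\
       {ae P, forall om, exists C : R, forall i k, (1 <= k)%N -> (M i k om <= C%:E)%E})
  (* (A3) *)
  (A3 : \rank (laplacian a) = N.-1)
  (* (A4) *)
  (d_meas : forall i k, (1 <= k)%N -> measurable_fun setT (d i k))
  (d_lap : forall i k (x : R), (1 <= k)%N ->
     P [set om | d i k om <= x] = (lap_cdf x)%:E)
  (d_indep : forall (s : seq ('I_N * nat)) (B : 'I_N -> nat -> set R) (A : set Omega),
     uniq s -> all (fun q => (1 <= q.2)%N) s ->
     (forall i k, measurable (B i k)) -> <<s gen_w_all w >> A ->
     P (A `&` \big[setI/setT]_(q <- s) (d q.1 q.2 @^-1` B q.1 q.2))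
     = (P A * \prod_(q <- s) P (d q.1 q.2 @^-1` B q.1 q.2))%E)
  (* step sizes *)
  (step_i : forall i j, 0 < a i j ->
     (\sum_(1 <= k <oo) ((alpha i j k) ^+ 2)%:E < +oo)%E /\
     exists C : R, forall k, (1 <= k)%N -> alpha i j k.+1 / alpha i j k <= C)
  (step_ii : forall i,
     (\sum_(1 <= k <oo) ((beta i k) ^+ 2)%:E < +oo)%E /\
     exists C : R, forall k, (1 <= k)%N -> beta i k.+1 / beta i k <= C)
  (step_iii : (\sum_(1 <= k <oo)
     Order.min
       (\big[Order.min/+oo%E]_(i < N) \big[Order.min/+oo%E]_(j < N | (0 < a i j)%R)
          (alpha i j k / (k%:R `^ nu i j))%R%:E)
       (\big[Order.min/+oo%E]_(i < N) (beta i k)%:E) = +oo)%E) :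
  forall i : 'I_N,
    {ae P, forall om,
      (fun k => sc_est a nu b alpha beta H theta theta0 w d k om i) @ \oo --> theta}.
Proof.
move=> i0.
have [Hbar [Hb0 hH]] := A1_bound; have [p [delta [p0 [delta0 hpe]]]] := A1_pe.
have [rho [rho2 [M [M_meas [M_int M_bd]]]]] := A2_moment.
pose c := Hbar ^+ 2; have c0 : 0 < c by rewrite exprn_gt0.
have H_le i k x : (1 <= k)%N -> nsq (H i k *m x) <= c * nsq x.
  by move=> k1; apply: opnorm_nsq (hH i k k1); exact: ltW.
have H_pe k x (k1 : (1 <= k)%N) := loewner_excitation x (hpe k k1).
have beta_sum i : exists B, forall k, \sum_(t < k) beta i t.+1 ^+ 2 <= B.
  by apply: (@eseries_bounded_partial_sums R (fun k => beta i k ^+ 2)) => [k|];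
    [exact: sqr_ge0|exact: (step_ii i).1].
have gain_sum i j : exists B, forall k, \sum_(t < k) gain a alpha t i j ^+ 2 <= B.
  have [e|ne] := boolP (0 < a i j); last first.
    exists 0 => k; rewrite big1// => t _; rewrite /gain (_ : a i j = 0) ?mulr0 ?expr0n//.
    by apply/eqP; rewrite eq_le a_ge0 andbT leNgt.
  apply: (@bounded_partial_sums_le R (fun t => gain a alpha t i j ^+ 2) (fun t => alpha i j t.+1
    ^+ 2) (a i j ^+ 2)).
  - exact: sqr_ge0.
  - by move=> k; rewrite /gain exprMn mulrC.
  - by apply: (@eseries_bounded_partial_sums R (fun k => alpha i j k ^+ 2)) => [k|];
      [exact: sqr_ge0|exact: (step_i i j e).1].
have [z [Cz [z0 [Cz1 zS] zal zbe zoo]]] := min_step_size i0 nu_ge0 alpha_gt0 beta_gt0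
  (fun i j e => (step_i i j e).2) (fun i => (step_ii i).2) step_iii.
have bit_ae : {ae P, forall om, forall i j, cvgn (fun k => \sum_(t < k) gain a alpha t i j *
    bit_noise a nu b alpha beta H theta theta0 w d t om j i *
    (dotv (phi n t.+1) (err a nu b alpha beta H theta theta0 w d t om i) /
     (1 + lyap a nu b alpha beta H theta theta0 w d t om)))}.
  apply: filter_forall => i; apply: filter_forall => j.
  have [e|ne] := boolP (0 < a i j); first exact: bit_series_cvg.
  apply: nearW => om; rewrite (_ : (fun k => _) = cst 0); first exact: is_cvg_cst.
  apply/funext => k; rewrite big1// => t _; rewrite /gain (_ : a i j = 0) ?mulr0 ?mul0r//.
  by apply/eqP; rewrite eq_le a_ge0 andbT leNgt.
(* The levels [K] are integers, so one null set serves all of them and [K] may be chosen afterwards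
   for each outcome. *)
have obs_ae : {ae P, forall om, forall (K : nat) i (r : 'I_(m i)), cvgn (fun k =>
    \sum_(t < k) beta i t.+1 * (truncated M K i t om * w i t.+1 om r 0) *
    ((H i t.+1 *m err a nu b alpha beta H theta theta0 w d t om i) r 0 /
     (1 + lyap a nu b alpha beta H theta theta0 w d t om)))}.
  apply: ae_foralln => K; apply: filter_forall => i; apply: filter_forall => r.
  by apply: (@obs_series_cvg _ _ _ P _ _ _ _ _ _ _ _ _ _ _ _ _ _ _ _ _ rho _ M _ _ c).
have sum_ae : {ae P, forall om, forall (K : nat) i, exists B, forall k,
    \sum_(t < k) beta i t.+1 ^+ 2 * (truncated M K i t om * nsq (w i t.+1 om)) <= B}.
  apply: ae_foralln => K; apply: filter_forall => i.
  by apply: (@truncated_energy_sum _ _ _ P _ _ _ _ d _ _ rho).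
apply: filterS (filterI (filterI bit_ae obs_ae) (filterI sum_ae M_bd)) => om [[h1 h2] [h3 [C hC]]].
(* This level exceeds the random bound [C] of this outcome, so no term is truncated here and the
   truncated series are the true ones. *)
pose K := (Num.trunc C).+1.
have tr i t : truncated M K i t om = 1.
  rewrite /truncated indicE mem_set// /moment_le/=; apply: le_trans (hC i t.+1 isT) _.
  by rewrite lee_fin ltW// truncnS_gt.
have V0 : lyap a nu b alpha beta H theta theta0 w d k om @[k --> \oo] --> (0 : R).
  apply: (@lyap_cvg0 _ _ _ _ _ _ _ _ _ _ _ _ _ _ _ a_sym a_ge0 nu_sym nu_ge0 b_sym b_gt0
    alpha_sym alpha_gt0 beta_gt0 c c0 H_le A3 p delta p0 delta0 H_pe gain_sum beta_sum z Cz) => //.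
  - move=> i r; have := h2 K i r; under eq_fun do under eq_bigr do rewrite tr mul1r.
    exact.
  - move=> i; have [B hB] := h3 K i; exists B => k; have := hB k.
    by under eq_bigr do rewrite tr mul1r.
apply: cvg_col_nsq; apply: (squeeze_cvgr _ (@cvg_cst _ 0 _ _ _) V0).
apply: nearW => k; rewrite nsq_ge0/=.
exact: (err_nsq_le a nu b alpha beta H theta theta0 w d k om i0).
Qed.
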